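(* Let $K$ be an algebraically closed field of characteristic $3$ and let $A$ be one of the algebras $\Lambda_1$ or $\Lambda_2$. Then: (i) $\dim_K HH^0(A)=5$. (ii) $\dim_K HH^1(A)=3$. (iii) $\dim_K HH^2(A)=3$.
   Context: For a finite-dimensional $K$-algebra $A$, $HH^n(A)=\mathrm{Ext}^n_{A^e}(A,A)$ with $A^e=A^{\mathrm{op}}\otimes_K A$ is the $n$-th Hochschild cohomology space. Paths are composed from left to right ($\alpha\beta$ means first $\alpha$, then $\beta$). Let $Q$ be the quiver with vertices $1,2$ and arrows $\alpha:2\to2$, $\gamma:2\to1$, $\beta:1\to2$. $\Lambda_1$ is the bound quiver algebra of $Q$ with relations $\alpha^2=\gamma\beta$, $\beta\alpha\gamma=\beta\alpha^2\gamma$, $\alpha^5=0$. $\Lambda_2$ is the bound quiver algebra of $Q$ with relations $\alpha^2\gamma=0$, $\beta\alpha^2=0$, $\beta\gamma=\beta\alpha\gamma$, $\alpha^3=\gamma\beta$. *)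

(* Defs.v *)
From HB Require Import structures.
From mathcomp Require Import all_boot all_order all_algebra all_field.
From mathcomp Require Import finmap.
From mathcomp.multinomials Require Import monalg.

Set Implicit Arguments.
Unset Strict Implicit.
Unset Printing Implicit Defensive.

Import GRing.Theory.
Local Open Scope ring_scope.

(* The nonemptiness of the vertex set is what makes the path algebra a
   nontrivial ring, as required by [algType]. *)
Record quiver := Quiver {
  vertex : finType;
  arrow : finType;
  src : arrow -> vertex;
  tgt : arrow -> vertex;
  vertex_gt0 : (0 < #|vertex|)%N
}.

Section Paths.
Variable Q : quiver.
Implicit Types (v w : vertex Q) (s t : seq (arrow Q)).

(* [(v, [:: a1; ...; an])] is a path when a1 starts at v and each arrow starts
   where the previous one ends; [(v, [::])] is the trivial path at v. *)
Fixpoint walk v s : bool :=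
  if s is a :: s' then (src a == v) && walk (tgt a) s' else true.

Definition walk_end v s : vertex Q := last v (map (@tgt Q) s).

Record qpath := QPath {
  path_val : vertex Q * seq (arrow Q);
  _ : walk path_val.1 path_val.2
}.

HB.instance Definition _ := [isSub for path_val].
HB.instance Definition _ := [Choice of qpath by <:].

Definition path_src (p : qpath) : vertex Q := (val p).1.
Definition path_tgt (p : qpath) : vertex Q := walk_end (val p).1 (val p).2.

Definition triv_path v : qpath := @QPath (v, [::]) isT.

Lemma walk_arrow (a : arrow Q) : walk (src a) [:: a].
Proof. by rewrite /= eqxx. Qed.

Definition arrow_path (a : arrow Q) : qpath := @QPath (src a, [:: a]) (walk_arrow a).

Lemma walk_cat v s t : walk v (s ++ t) = walk v s && walk (walk_end v s) t.
Proof. by elim: s v => //= a s IH v; rewrite IH andbA. Qed.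

Lemma walk_end_cat v s t : walk_end v (s ++ t) = walk_end (walk_end v s) t.
Proof. by rewrite /walk_end map_cat last_cat. Qed.

(* Paths compose from left to right: [pcat p q] is p followed by q. The call to
   [insub] never fails. *)
Definition pcat (p q : qpath) : option qpath :=
  if path_tgt p == path_src q then insub (path_src p, (val p).2 ++ (val q).2)
  else None.

Lemma pcatP (p q r : qpath) :
  pcat p q = Some r <->
  path_tgt p = path_src q /\ val r = (path_src p, (val p).2 ++ (val q).2).
Proof.
rewrite /pcat; split.
  by case: eqP => // -> ; case: insubP => //= u _ <- [<-].
case=> -> h; rewrite eqxx; case: insubP => [u _ hu|].
  by congr Some; apply: val_inj; rewrite hu h.
by rewrite -h (valP r).
Qed.

Lemma pcatE (p q : qpath) : path_tgt p = path_src q ->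
  exists2 r, pcat p q = Some r & val r = (path_src p, (val p).2 ++ (val q).2).
Proof.
move=> h.
have w : walk (path_src p) ((val p).2 ++ (val q).2).
  by rewrite walk_cat (valP p) /= -/(path_tgt p) h (valP q).
by exists (@QPath (path_src p, (val p).2 ++ (val q).2) w) => //; apply/pcatP.
Qed.

Lemma pcat_src (p q r : qpath) : pcat p q = Some r -> path_src r = path_src p.
Proof. by move/pcatP=> [_ h]; rewrite {1}/path_src h. Qed.

Lemma pcat_tgt (p q r : qpath) : pcat p q = Some r -> path_tgt r = path_tgt q.
Proof.
move/pcatP=> [h1 h2]; rewrite {1}/path_tgt h2 /= walk_end_cat.
by rewrite -/(path_tgt p) h1.
Qed.

Lemma pcatA (p q r : qpath) :
  obind (fun x => pcat x r) (pcat p q) = obind (pcat p) (pcat q r).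
Proof.
have [e1|n1] := eqVneq (path_tgt p) (path_src q); last first.
  have -> : pcat p q = None by rewrite /pcat (negbTE n1).
  case h: (pcat q r) => [x|] //=.
  by rewrite /pcat (pcat_src h) (negbTE n1).
have [x hx vx] := pcatE e1; rewrite hx /=.
have [e2|n2] := eqVneq (path_tgt q) (path_src r); last first.
  have -> : pcat q r = None by rewrite /pcat (negbTE n2).
  by rewrite /pcat (pcat_tgt hx) (negbTE n2).
have [y hy vy] := pcatE e2; rewrite hy /=.
have [z hz vz] : exists2 z, pcat x r = Some z &
    val z = (path_src x, (val x).2 ++ (val r).2).
  by apply: pcatE; rewrite (pcat_tgt hx).
rewrite hz; apply/esym/pcatP; rewrite (pcat_src hy); split=> //.
by rewrite vz (pcat_src hx) vx vy /= catA.
Qed.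

Lemma pcat_trivl v (p : qpath) :
  pcat (triv_path v) p = if v == path_src p then Some p else None.
Proof.
case: eqP => [e|/eqP ne]; last by rewrite /pcat /path_tgt /= (negbTE ne).
apply/pcatP; split; first exact: e.
by rewrite -[path_src (triv_path v)]/v e /path_src -surjective_pairing.
Qed.

Lemma pcat_trivr v (p : qpath) :
  pcat p (triv_path v) = if v == path_tgt p then Some p else None.
Proof.
case: eqP => [e|/eqP ne]; last by rewrite /pcat /path_src eq_sym /= (negbTE ne).
by move=> /=; apply/pcatP; split=> //=; rewrite cats0 /path_src -surjective_pairing.
Qed.

End Paths.

Section PathAlgebra.
Variables (K : fieldType) (Q : quiver).

Definition path_algebra : Type := {malg K[qpath Q]}.
HB.instance Definition _ := GRing.Lmodule.on path_algebra.

Implicit Types (f g h : path_algebra) (p q r : qpath Q).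

Definition path_elt p : path_algebra := << p >>.

Definition path_elt_opt (o : option (qpath Q)) : path_algebra :=
  if o is Some r then path_elt r else 0.

Definition path_one : path_algebra := \sum_(v : vertex Q) path_elt (triv_path v).

Definition path_mul f g : path_algebra :=
  \sum_(p <- msupp f) \sum_(q <- msupp g)
    (f@_p * g@_q) *: path_elt_opt (pcat p q).

Definition path_lift (V : lmodType K) (F : qpath Q -> V) f : V :=
  \sum_(p <- msupp f) f@_p *: F p.

Lemma path_liftw (V : lmodType K) (F : qpath Q -> V) f (d : {fset qpath Q}) :
  (msupp f `<=` d)%fset -> path_lift F f = \sum_(p <- d) f@_p *: F p.
Proof.
move=> le; rewrite /path_lift; apply: big_fset_incl => // p _ np.
by rewrite mcoeff_outdom // scale0r.
Qed.

Lemma path_lift_is_linear (V : lmodType K) (F : qpath Q -> V) :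
  linear (path_lift F).
Proof.
move=> c f g; set d := (msupp f `|` msupp g `|` msupp (c *: f + g))%fset.
rewrite (@path_liftw V F (c *: f + g) d) ?fsubsetUr //.
rewrite (@path_liftw V F f d) ?(@path_liftw V F g d); first last.
- by rewrite /d -fsetUA fsubsetUl.
- by rewrite /d (fsetUC (msupp f)) -fsetUA fsubsetUl.
rewrite scaler_sumr -big_split; apply: eq_bigr => p _ /=.
by rewrite mcoeffD mcoeffZ scalerDl scalerA.
Qed.

HB.instance Definition _ (V : lmodType K) (F : qpath Q -> V) :=
  GRing.isLinear.Build K path_algebra V _ (path_lift F)
    (@path_lift_is_linear V F).

Lemma path_lift_elt (V : lmodType K) (F : qpath Q -> V) p :
  path_lift F (path_elt p) = F p.
Proof.
rewrite /path_lift /path_elt msuppU oner_eq0 big_seq_fset1.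
by rewrite mcoeffUU scale1r.
Qed.

Lemma path_expand f : f = \sum_(p <- msupp f) f@_p *: path_elt p.
Proof.
rewrite {1}[f]monalgE; apply: eq_bigr => p _; apply/malgP => q.
by rewrite mcoeffZ !mcoeffU mulrnAr mulr1.
Qed.

Lemma path_ext (V : lmodType K) (F G : {linear path_algebra -> V}) :
  (forall p, F (path_elt p) = G (path_elt p)) -> F =1 G.
Proof.
move=> e f; rewrite [f]path_expand !linear_sum; apply: eq_bigr => p _.
by rewrite !linearZ /= e.
Qed.

Lemma path_mulE f g :
  path_mul f g = path_lift (fun p => path_lift (fun q => path_elt_opt (pcat p q)) g) f.
Proof.
rewrite /path_mul /path_lift; apply: eq_bigr => p _; rewrite scaler_sumr.
by apply: eq_bigr => q _; rewrite scalerA.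
Qed.

Lemma path_mul_elt p q : path_mul (path_elt p) (path_elt q) = path_elt_opt (pcat p q).
Proof. by rewrite path_mulE !path_lift_elt. Qed.

Lemma path_mul_linearl g : linear (path_mul^~ g).
Proof. by move=> c f f'; rewrite !path_mulE linearP. Qed.

Lemma path_mul_linearr f : linear (path_mul f).
Proof.
move=> c g g'; rewrite !path_mulE /path_lift !scaler_sumr -big_split /=.
apply: eq_bigr => p _; rewrite -!/(path_lift _ _) linearP scalerDr.
by rewrite !scalerA mulrC.
Qed.

Definition path_mull g (f : path_algebra) := path_mul f g.
HB.instance Definition _ g :=
  GRing.isLinear.Build K path_algebra path_algebra _ (path_mull g)
    (path_mul_linearl g).
HB.instance Definition _ f :=
  GRing.isLinear.Build K path_algebra path_algebra _ (path_mul f)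
    (path_mul_linearr f).

Lemma path_mulA : associative path_mul.
Proof.
move=> f g h.
have E1 p q r : path_mul (path_elt p) (path_mul (path_elt q) (path_elt r)) =
                path_mul (path_mul (path_elt p) (path_elt q)) (path_elt r).
  rewrite !path_mul_elt; have := pcatA p q r.
  case: (pcat p q) (pcat q r) => [x|] [y|] /=; rewrite ?path_mul_elt.
  - by move=> ->.
  - by move=> ->; rewrite linear0.
  - by move=> <-; rewrite -/(path_mull _ 0) linear0.
  - by rewrite linear0 -/(path_mull _ 0) linear0.
have E2 p q : path_mul (path_elt p) (path_mul (path_elt q) h) =
              path_mul (path_mul (path_elt p) (path_elt q)) h.
  exact: (@path_ext _ (path_mul (path_elt p) \o path_mul (path_elt q))
           (path_mul (path_mul (path_elt p) (path_elt q))) (E1 p q) h).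
have E3 p : path_mul (path_elt p) (path_mul g h) =
            path_mul (path_mul (path_elt p) g) h.
  exact: (@path_ext _ (path_mul (path_elt p) \o path_mull h)
           (path_mull h \o path_mul (path_elt p)) (E2 p) g).
exact: (@path_ext _ (path_mull (path_mul g h))
         (path_mull h \o path_mull g) E3 f).
Qed.

Lemma path_mul1f : left_id path_one path_mul.
Proof.
apply: (@path_ext _ (path_mul path_one) idfun) => p /=.
rewrite -/(path_mull _ _) /path_one linear_sum /= (bigD1 (path_src p)) //=.
rewrite /path_mull path_mul_elt pcat_trivl eqxx /= big1 ?addr0 // => v nv.
by rewrite path_mul_elt pcat_trivl (negbTE nv).
Qed.

Lemma path_mulf1 : right_id path_one path_mul.
Proof.
apply: (@path_ext _ (path_mull path_one) idfun) => p /=.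
rewrite /path_mull /path_one linear_sum /= (bigD1 (path_tgt p)) //=.
rewrite path_mul_elt pcat_trivr eqxx /= big1 ?addr0 // => v nv.
by rewrite path_mul_elt pcat_trivr (negbTE nv).
Qed.

Lemma path_mulDl : left_distributive path_mul +%R.
Proof. by move=> f g h; rewrite -!/(path_mull h _) linearD. Qed.

Lemma path_mulDr : right_distributive path_mul +%R.
Proof. by move=> f g h; rewrite linearD. Qed.

Lemma path_one_neq0 : path_one != 0.
Proof.
have /card_gt0P[v _] := vertex_gt0 Q.
apply/eqP => /(congr1 (fun f => path_mul f (path_elt (triv_path v)))).
rewrite path_mul1f -/(path_mull _ 0) linear0.
by move/eqP; rewrite monalgU_eq0 oner_eq0.
Qed.

HB.instance Definition _ := GRing.Zmodule_isNzRing.Build path_algebra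
  path_mulA path_mul1f path_mulf1 path_mulDl path_mulDr path_one_neq0.

Lemma path_scalerAl (c : K) (f g : path_algebra) : c *: (f * g) = (c *: f) * g.
Proof. by rewrite -[RHS]/(path_mull g (c *: f)) linearZ. Qed.

Lemma path_scalerAr (c : K) (f g : path_algebra) : c *: (f * g) = f * (c *: g).
Proof. by rewrite -[RHS]/(path_mul f (c *: g)) linearZ. Qed.

HB.instance Definition _ :=
  GRing.Lmodule_isLalgebra.Build K path_algebra path_scalerAl.
HB.instance Definition _ :=
  GRing.Lalgebra_isAlgebra.Build K path_algebra path_scalerAr.

Definition arrow_elt (a : arrow Q) : path_algebra := path_elt (arrow_path a).

End PathAlgebra.

Definition in_ideal (R : nzRingType) (rels : seq R) (x : R) : Prop :=
  exists (n : nat) (a r b : 'I_n -> R),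
    (forall i, r i \in rels) /\ x = \sum_(i < n) a i * r i * b i.

(* A is isomorphic, as a K-algebra, to KQ/I, where I is the two-sided ideal
   generated by rels: phi is the composite of KQ -> KQ/I with an isomorphism
   KQ/I -> A. *)
Definition bound_quiver_algebra (K : fieldType) (Q : quiver)
    (rels : seq (path_algebra K Q)) (A : falgType K) : Prop :=
  exists phi : {lrmorphism path_algebra K Q -> A},
    (forall y, exists x, phi x = y) /\ (forall x, phi x = 0 <-> in_ideal rels x).

Variant Qvertex := V1 | V2.
Variant Qarrow := Alpha | Beta | Gamma.

Definition Qvertex_code (v : Qvertex) : bool := if v is V1 then false else true.
Definition Qvertex_decode (b : bool) : Qvertex := if b then V2 else V1.
Lemma Qvertex_codeK : cancel Qvertex_code Qvertex_decode.
Proof. by case. Qed.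
HB.instance Definition _ := Finite.copy Qvertex (can_type Qvertex_codeK).

Definition Qarrow_code (a : Qarrow) : option bool :=
  match a with Alpha => None | Beta => Some false | Gamma => Some true end.
Definition Qarrow_decode (b : option bool) : Qarrow :=
  match b with None => Alpha | Some false => Beta | Some true => Gamma end.
Lemma Qarrow_codeK : cancel Qarrow_code Qarrow_decode.
Proof. by case. Qed.
HB.instance Definition _ := Finite.copy Qarrow (can_type Qarrow_codeK).

Lemma Qvertex_gt0 : (0 < #|(Qvertex : finType)|)%N.
Proof. by apply/card_gt0P; exists V1. Qed.

Definition Q : quiver := @Quiver Qvertex Qarrow
  (fun a => match a with Alpha => V2 | Beta => V1 | Gamma => V2 end)
  (fun a => match a with Alpha => V2 | Beta => V2 | Gamma => V1 end)
  Qvertex_gt0.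

Section Lambda.
Variable K : fieldType.

Local Notation alpha := (@arrow_elt K Q Alpha).
Local Notation beta := (@arrow_elt K Q Beta).
Local Notation gamma := (@arrow_elt K Q Gamma).

Definition Lambda1_rels : seq (path_algebra K Q) :=
  [:: alpha ^+ 2 - gamma * beta;
      beta * alpha * gamma - beta * alpha ^+ 2 * gamma;
      alpha ^+ 5].

Definition Lambda2_rels : seq (path_algebra K Q) :=
  [:: alpha ^+ 2 * gamma;
      beta * alpha ^+ 2;
      beta * gamma - beta * alpha * gamma;
      alpha ^+ 3 - gamma * beta].

Definition is_Lambda1 (A : falgType K) := bound_quiver_algebra Lambda1_rels A.
Definition is_Lambda2 (A : falgType K) := bound_quiver_algebra Lambda2_rels A.

End Lambda.

Definition projective (R : nzRingType) (P : lmodType R) : Prop :=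
  forall (U V : lmodType R) (g : {linear U -> V}) (f : {linear P -> V}),
    (forall v, exists u, g u = v) ->
    exists h : {linear P -> U}, forall x, g (h x) = f x.

Record proj_resolution (R : nzRingType) (M : lmodType R) := ProjResolution {
  res_obj :> nat -> lmodType R;
  res_diff : forall n, {linear res_obj n.+1 -> res_obj n};
  res_aug : {linear res_obj 0%N -> M};
  res_projective : forall n, projective (res_obj n);
  res_aug_surj : forall y, exists x, res_aug x = y;
  res_exact0 : forall x, res_aug x = 0 <-> exists y, x = res_diff 0%N y;
  res_exact : forall n x, res_diff n x = 0 <-> exists y, x = res_diff n.+1 y
}.

Section Ext.
Variables (K : fieldType) (R : algType K) (M N : lmodType R).
Variable P : proj_resolution M.

Definition Ext_cocycle (n : nat) (f : P n -> N) : Prop :=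
  forall x, f (res_diff P n x) = 0.

Definition Ext_coboundary (n : nat) : (P n -> N) -> Prop :=
  match n with
  | 0%N => fun f => forall x, f x = 0
  | m.+1 => fun f => exists g : {linear P m -> N}, forall x, f x = g (res_diff P m x)
  end.

(* The n-th cohomology space of Hom_R(P, N) has a K-basis with d elements, the
   classes of the z i; a scalar c acts on N as c%:A. *)
Definition cohomology_dim (n d : nat) : Prop :=
  exists z : 'I_d -> {linear P n -> N},
    (forall i, Ext_cocycle (z i)) /\
    (forall f : {linear P n -> N}, Ext_cocycle f ->
       exists! c : 'rV[K]_d,
         Ext_coboundary (fun x => f x - \sum_i (c 0 i)%:A *: z i x)).

End Ext.

(* dim_K Ext^n_R(M, N) = d. Ext is computed by any projective resolution of M,
   hence the universal quantifier; the first conjunct keeps it from being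
   vacuous. *)
Definition Ext_dim (K : fieldType) (R : algType K) (M N : lmodType R)
    (n d : nat) : Prop :=
  inhabited (proj_resolution M) /\
  forall P : proj_resolution M, cohomology_dim N P n d.

Section Enveloping.
Variables (K : fieldType) (A : falgType K).

Local Notation n := (\dim {:A}).
Local Notation e := (vbasis {:A}).

(* A^op (x) A, in coordinates: the matrix M stands for
   \sum_(i, j) M i j *: (e_i (x) e_j), where e is a basis of A. *)
Definition enveloping : Type := 'M[K]_n.
HB.instance Definition _ := GRing.Lmodule.on enveloping.
HB.instance Definition _ := Vector.on enveloping.

Definition tens (a b : A) : enveloping :=
  \matrix_(i < n, j < n) (coord e i a * coord e j b).

Definition env_lift (V : lmodType K) (F : A -> A -> V) (M : enveloping) : V :=
  \sum_(i < n) \sum_(j < n) M i j *: F e`_i e`_j.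

(* (a (x) b) (a' (x) b') = a' a (x) b b', see env_mul_tens below. *)
Definition env_mul (M N : enveloping) : enveloping :=
  env_lift (fun a b => env_lift (fun a' b' => tens (a' * a) (b * b')) N) M.

Definition env_one : enveloping := tens 1 1.

Lemma env_lift_is_linear (V : lmodType K) (F : A -> A -> V) : linear (env_lift F).
Proof.
move=> c M N; rewrite /env_lift scaler_sumr -big_split; apply: eq_bigr => i _ /=.
rewrite scaler_sumr -big_split; apply: eq_bigr => j _ /=.
by rewrite !mxE scalerDl scalerA.
Qed.

HB.instance Definition _ (V : lmodType K) (F : A -> A -> V) :=
  GRing.isLinear.Build K enveloping V _ (env_lift F) (@env_lift_is_linear V F).

Lemma tens_linearl b : linear (tens^~ b).
Proof. by move=> c a a'; apply/matrixP=> i j; rewrite !mxE linearP mulrDl -mulrA. Qed.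

Lemma tens_linearr a : linear (tens a).
Proof.
by move=> c b b'; apply/matrixP=> i j; rewrite !mxE linearP mulrDr mulrCA.
Qed.

Definition tensl b a := tens a b.
HB.instance Definition _ b :=
  GRing.isLinear.Build K A enveloping _ (tensl b) (tens_linearl b).
HB.instance Definition _ a :=
  GRing.isLinear.Build K A enveloping _ (tens a) (tens_linearr a).

Lemma env_basis_expand (a : A) : a = \sum_(i < n) coord e i a *: e`_i.
Proof. by apply: coord_vbasis; rewrite memvf. Qed.

Lemma env_lift_tens (V : lmodType K) (F : A -> A -> V) :
  (forall b, linear (F^~ b)) -> (forall a, linear (F a)) ->
  forall a b, env_lift F (tens a b) = F a b.
Proof.
move=> Fl Fr a b.
pose Fl' b := HB.pack_for {linear A -> V} (F^~ b)
  (GRing.isLinear.Build K A V _ (F^~ b) (Fl b)).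
pose Fr' a := HB.pack_for {linear A -> V} (F a)
  (GRing.isLinear.Build K A V _ (F a) (Fr a)).
rewrite {2}[a]env_basis_expand -[RHS]/(Fl' b _) linear_sum /env_lift.
apply: eq_bigr => i _; rewrite linearZ /=.
rewrite {2}[b]env_basis_expand -[F _ _]/(Fr' e`_i _) linear_sum scaler_sumr.
by apply: eq_bigr => j _; rewrite linearZ mxE scalerA.
Qed.

Lemma env_expand (M : enveloping) :
  M = \sum_(i < n) \sum_(j < n) M i j *: tens e`_i e`_j.
Proof.
apply/matrixP=> i j; rewrite summxE (bigD1 i) //= summxE (bigD1 j) //=.
have fe := basis_free (vbasisP {:A}).
have co (k l : 'I_n) : coord e k e`_l = (k == l)%:R.
  by rewrite (coord_free _ _ fe) eq_sym.
rewrite !mxE !co !eqxx !mulr1 big1 => [|l nl]; last first.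
  by rewrite !mxE !co [j == l]eq_sym (negbTE nl) !mulr0.
rewrite big1 ?addr0 // => k nk; rewrite summxE big1 // => l _.
by rewrite !mxE !co [i == k]eq_sym (negbTE nk) mul0r mulr0.
Qed.

Lemma env_ext (V : lmodType K) (F G : {linear enveloping -> V}) :
  (forall a b, F (tens a b) = G (tens a b)) -> F =1 G.
Proof.
move=> h M; rewrite [M]env_expand !linear_sum; apply: eq_bigr => i _.
by rewrite !linear_sum; apply: eq_bigr => j _; rewrite !linearZ /= h.
Qed.

Lemma env_mul_linearl N : linear (env_mul^~ N).
Proof. by move=> c M M'; rewrite /env_mul linearP. Qed.

Lemma env_mul_linearr M : linear (env_mul M).
Proof.
move=> c N N'; rewrite /env_mul {1 3 5}/env_lift scaler_sumr -big_split.
apply: eq_bigr => i _ /=; rewrite scaler_sumr -big_split; apply: eq_bigr => j _ /=.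
by rewrite linearP scalerDr !scalerA mulrC.
Qed.

Definition env_mull N M := env_mul M N.
HB.instance Definition _ N :=
  GRing.isLinear.Build K enveloping enveloping _ (env_mull N) (env_mul_linearl N).
HB.instance Definition _ M :=
  GRing.isLinear.Build K enveloping enveloping _ (env_mul M) (env_mul_linearr M).

Lemma env_mul_tens a b a' b' :
  env_mul (tens a b) (tens a' b') = tens (a' * a) (b * b').
Proof.
have E1 x y : env_lift (fun c d => tens (c * x) (y * d)) (tens a' b') =
              tens (a' * x) (y * b').
  apply: env_lift_tens => [v|u] c u1 u2 /=.
    by rewrite mulrDl -scalerAl tens_linearl.
  by rewrite mulrDr -scalerAr tens_linearr.
rewrite /env_mul env_lift_tens // => [v|u] c u1 u2 /=; rewrite !E1.
  by rewrite mulrDr -scalerAr tens_linearl.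
by rewrite mulrDl -scalerAl tens_linearr.
Qed.

Lemma env_mulA : associative env_mul.
Proof.
move=> M N L.
have E2 a b a' b' : env_mul (tens a b) (env_mul (tens a' b') L) =
                    env_mul (env_mul (tens a b) (tens a' b')) L.
  apply: (@env_ext _ (env_mul (tens a b) \o env_mul (tens a' b'))
           (env_mul (env_mul (tens a b) (tens a' b'))) _ L) => c d /=.
  by rewrite !env_mul_tens !mulrA.
have E3 a b : env_mul (tens a b) (env_mul N L) =
              env_mul (env_mul (tens a b) N) L.
  exact: (@env_ext _ (env_mul (tens a b) \o env_mull L)
           (env_mull L \o env_mul (tens a b)) (E2 a b) N).
exact: (@env_ext _ (env_mull (env_mul N L)) (env_mull L \o env_mull N) E3 M).
Qed.

Lemma env_mul1m : left_id env_one env_mul.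
Proof.
apply: (@env_ext _ (env_mul env_one) idfun) => a b /=.
by rewrite env_mul_tens mulr1 mul1r.
Qed.

Lemma env_mulm1 : right_id env_one env_mul.
Proof.
apply: (@env_ext _ (env_mull env_one) idfun) => a b /=.
by rewrite /env_mull env_mul_tens mulr1 mul1r.
Qed.

Lemma env_mulDl : left_distributive env_mul +%R.
Proof. by move=> M N L; rewrite -!/(env_mull L _) linearD. Qed.

Lemma env_mulDr : right_distributive env_mul +%R.
Proof. by move=> M N L; rewrite linearD. Qed.

Lemma env_one_neq0 : env_one != 0.
Proof.
have [i ci] : exists i, coord e i (1 : A) != 0.
  apply/existsP; apply: contraT; rewrite negb_exists => /forallP h.
  have /eqP[] := oner_neq0 A; rewrite [1]env_basis_expand big1 // => i _.
  by move: (h i); rewrite negbK => /eqP ->; rewrite scale0r.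
apply/eqP => /matrixP/(_ i i); rewrite !mxE => /eqP.
by rewrite mulf_eq0 (negbTE ci).
Qed.

HB.instance Definition _ := GRing.Zmodule_isNzRing.Build enveloping
  env_mulA env_mul1m env_mulm1 env_mulDl env_mulDr env_one_neq0.

Lemma env_scalerAl (c : K) (M N : enveloping) : c *: (M * N) = (c *: M) * N.
Proof. by rewrite -[RHS]/(env_mull N (c *: M)) linearZ. Qed.

Lemma env_scalerAr (c : K) (M N : enveloping) : c *: (M * N) = M * (c *: N).
Proof. by rewrite -[RHS]/(env_mul M (c *: N)) linearZ. Qed.

HB.instance Definition _ :=
  GRing.Lmodule_isLalgebra.Build K enveloping env_scalerAl.
HB.instance Definition _ :=
  GRing.Lalgebra_isAlgebra.Build K enveloping env_scalerAr.

(* A as a left A^e-module: (a (x) b) *: x = b x a, which is an action because the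
   left factor of A^e is A^op; see env_act_tens below. *)
Definition env_module : Type := A.
HB.instance Definition _ := GRing.Zmodule.on env_module.

Definition env_act (M : enveloping) (x : env_module) : env_module :=
  env_lift (fun a b => b * (x : A) * a) M.

Lemma env_act_tens a b (x : A) : env_act (tens a b) x = b * x * a.
Proof.
rewrite /env_act env_lift_tens // => [v|u] c u1 u2 /=.
  by rewrite mulrDr -scalerAr.
by rewrite !mulrDl -!scalerAl.
Qed.

Lemma env_act_is_linear M (c : K) (x y : A) :
  env_act M (c *: x + y) = c *: (env_act M x : A) + env_act M y.
Proof.
rewrite /env_act /env_lift scaler_sumr -big_split; apply: eq_bigr => i _ /=.
rewrite scaler_sumr -big_split; apply: eq_bigr => j _ /=.
by rewrite mulrDr mulrDl scalerDr -scalerAr -scalerAl !scalerA mulrC.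
Qed.

Lemma env_actA (M N : enveloping) (x : env_module) :
  env_act M (env_act N x) = env_act (M * N) x.
Proof.
have L0 (y : A) : linear (fun M => env_act M y : A).
  by move=> c M1 M2; rewrite /env_act linearP.
pose ev (y : A) := HB.pack_for {linear enveloping -> A} (fun M => env_act M y)
  (GRing.isLinear.Build K enveloping A _ (fun M => env_act M y) (L0 y)).
have L1 L : linear (env_act L : A -> A).
  by move=> c y z; rewrite env_act_is_linear.
pose act L := HB.pack_for {linear A -> A} (env_act L : A -> A)
  (GRing.isLinear.Build K A A _ (env_act L : A -> A) (L1 L)).
have E a b : env_act (tens a b) (env_act N x) = env_act (tens a b * N) x.
  apply: (@env_ext _ (act (tens a b) \o ev x)
           (ev x \o env_mul (tens a b)) _ N) => c d /=.
  by rewrite env_mul_tens !env_act_tens !mulrA.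
exact: (@env_ext _ (ev (env_act N x)) (ev x \o env_mull N) E M).
Qed.

Lemma env_act1 : left_id (1 : enveloping) env_act.
Proof. by move=> x; rewrite -[1]/(tens 1 1) env_act_tens mul1r mulr1. Qed.

Lemma env_actDr : right_distributive env_act +%R.
Proof.
move=> M x y; have := env_act_is_linear M 1 x y.
by rewrite !scale1r.
Qed.

Lemma env_actDl (x : env_module) : {morph env_act^~ x : M N / M + N}.
Proof. by move=> M N; rewrite /env_act linearD. Qed.

HB.instance Definition _ := GRing.Zmodule_isLmodule.Build enveloping env_module
  env_actA env_act1 env_actDr env_actDl.

End Enveloping.

Definition HH_dim (K : fieldType) (A : falgType K) (n d : nat) : Prop :=
  @Ext_dim K (enveloping A) (env_module A) (env_module A) n d.

(* Main.v *)
(* Ext over the enveloping algebra can be computed from any partial projective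
   resolution, so the point is to exhibit one in degrees at most 3. Each of the two
   algebras has an explicit basis of words with structure constants in the prime
   field: the words span because the relations rewrite every path to one of them, and
   they are independent because the multiplication table is a module over the path
   algebra killed by the relations. The minimal bimodule resolution starts with sums of
   2, 3, 2, 2 (resp. 2, 3, 4, 4) bimodules A e (x) f A; its exactness is witnessed by
   a contracting homotopy, and the dimensions of the cohomology of the complex of
   bimodule maps to A by an explicit splitting of the cochain spaces. All of these data
   were found by linear algebra over F_3; verifying them amounts to identities between
   tables of coefficients modulo 3. *)

From HB Require Import structures.
Require Import Defs.
From mathcomp Require Import all_boot all_order all_algebra all_field.
From mathcomp Require Import finmap.
From mathcomp.multinomials Require Import monalg.

Set Implicit Arguments.
Unset Strict Implicit.
Unset Printing Implicit Defensive.

Import GRing.Theory.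
Local Open Scope ring_scope.

(** * Free resolutions *)

(** [Ext_dim] quantifies over all projective resolutions, while the tables describe only degrees 0
    to 3. Hence the comparison theorem is proved in a form that asks for nothing above a given
    degree, and the existence of some full resolution is supplied separately, by free modules on all
    elements. The algebra A is abstract, known only through a surjection from the path algebra, so
    nothing in it can be evaluated. Linear maps are therefore compared through formal combinations
    of basis indices with natural coefficients, and characteristic 3 is what allows these
    coefficients to be compared modulo 3. The bimodules A e (x) f A are projective but in general
    not free. Each term is cut out of a free A^e-module by an idempotent, so the contraction reads d
    h + h d = idempotent, and cochains are vectors over A fixed by the dual idempotent. *)

Section LinearKernel.
Variables (R : nzRingType) (U V : lmodType R) (g : {linear U -> V}).

Definition lker_pred : {pred U} := [pred x | g x == 0].

Fact lker_submod_closed : submod_closed lker_pred.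
Proof.
split=> [|a x y]; rewrite !inE ?linear0 // linearP.
by move=> /eqP-> /eqP->; rewrite scaler0 addr0.
Qed.

HB.instance Definition _ := GRing.isSubmodClosed.Build R U lker_pred lker_submod_closed.

Record lker_type := LKer { lker_val : U; _ : lker_val \in lker_pred }.
HB.instance Definition _ := [isSub for lker_val].
HB.instance Definition _ := [Choice of lker_type by <:].
HB.instance Definition _ := [SubChoice_isSubLmodule of lker_type by <:].

Lemma lker_valK (x : lker_type) : g (val x) = 0.
Proof. exact/eqP/(valP x). Qed.

Lemma lker_valP (x : U) : g x = 0 -> exists y : lker_type, val y = x.
Proof. by move=> /eqP gx; exists (LKer gx). Qed.

End LinearKernel.

Section LinearOfProof.
Variables (R : pzRingType) (U V : lmodType R).

Lemma linear_of (f : U -> V) : linear f -> exists F : {linear U -> V}, F =1 f.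
Proof.
move=> lf; pose l := GRing.isLinear.Build R U V _ f lf.
by exists (HB.pack_for {linear U -> V} f l).
Qed.

End LinearOfProof.

(** Membership in the image of [g] is no boolean test, so the image is not formed as a module.
    Projectivity is applied to the pullback of [f] and [g], which is a kernel and projects onto [P];
    a section of that projection, followed by the projection to [U], is the lift. *)
Lemma projective_lift (R : nzRingType) (P U V : lmodType R)
    (g : {linear U -> V}) (f : {linear P -> V}) :
  projective P -> (forall x, exists u, g u = f x) ->
  exists h : {linear P -> U}, forall x, g (h x) = f x.
Proof.
move=> projP gf.
have [k kE] : exists k : {linear (P * U)%type -> V}, forall z, k z = f z.1 - g z.2.
  apply: linear_of => a [p u] [p' u'] /=.
  by rewrite (linearP f) (linearP g) scalerBr opprD addrACA.
have [q qE] : exists q : {linear lker_type k -> P}, forall z, q z = (val z).1.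
  by apply: linear_of => a z z'; rewrite linearP.
have [r rE] : exists r : {linear lker_type k -> U}, forall z, r z = (val z).2.
  by apply: linear_of => a z z'; rewrite linearP.
have [p|s sE] := projP _ _ q idfun.
  have [u gu] := gf p.
  have [|z zE] := @lker_valP _ _ _ k (p, u); first by rewrite kE gu subrr.
  by exists z; rewrite qE zE.
exists (r \o s) => x /=; have /eqP := lker_valK (s x).
by rewrite kE -rE -qE sE subr_eq0 => /eqP.
Qed.

Section FreeResolution.
Variable R : nzRingType.

Section FreeModule.
Variables (M V : lmodType R) (u : M -> V).

Definition malg_lift (x : {malg R[M]}) : V := \sum_(m <- msupp x) x@_m *: u m.

Lemma malg_liftw (x : {malg R[M]}) (d : {fset M}) :
  (msupp x `<=` d)%fset -> malg_lift x = \sum_(m <- d) x@_m *: u m.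
Proof.
move=> le; apply: big_fset_incl => // m _ nm.
by rewrite mcoeff_outdom // scale0r.
Qed.

Lemma malg_lift_linear : linear malg_lift.
Proof.
move=> c x y; set d := (msupp x `|` msupp y `|` msupp (c *: x + y))%fset.
rewrite (@malg_liftw (c *: x + y) d) ?fsubsetUr //.
rewrite (@malg_liftw x d) ?(@malg_liftw y d); first last.
- by rewrite /d -fsetUA fsubsetUl.
- by rewrite /d (fsetUC (msupp x)) -fsetUA fsubsetUl.
rewrite scaler_sumr -big_split; apply: eq_bigr => m _ /=.
by rewrite mcoeffD mcoeffZ scalerDl scalerA.
Qed.

HB.instance Definition _ :=
  GRing.isLinear.Build R {malg R[M]} V _ malg_lift malg_lift_linear.

Lemma malg_liftU m : malg_lift << m >> = u m.
Proof. by rewrite /malg_lift msuppU oner_eq0 big_seq_fset1 mcoeffUU scale1r. Qed.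

End FreeModule.

Lemma malg_lift_id (M V : lmodType R) (f : {linear {malg R[M]} -> V}) x :
  malg_lift (fun m => f << m >>) x = f x.
Proof.
rewrite {2}[x]monalgE linear_sum; apply: eq_bigr => m _; rewrite -linearZ.
congr (f _); apply/malgP => k.
by rewrite mcoeffZ !mcoeffU mulrnAr mulr1.
Qed.

Lemma malg_projective (M : lmodType R) : projective {malg R[M]}.
Proof.
move=> U V g f surj.
have ex v : exists u, g u == v by have [u <-] := surj v; exists u.
pose u m := xchoose (ex (f << m >>)).
exists (malg_lift u) => x; rewrite -[RHS]malg_lift_id /malg_lift linear_sum.
by apply: eq_bigr => m _; rewrite linearZ (eqP (xchooseP (ex _))).
Qed.

Definition free_cover (M : lmodType R) : {linear {malg R[M]} -> M} :=
  malg_lift (@id M).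

Fixpoint syzygy (M : lmodType R) n : lmodType R :=
  if n is n'.+1 then lker_type (free_cover (syzygy M n')) else M.

(** Settles the existence half of [Ext_dim]: each syzygy is covered by the free module on all its
    elements, which requires no finiteness. *)
Lemma free_resolution (M : lmodType R) : inhabited (proj_resolution M).
Proof.
pose F n : lmodType R := {malg R[syzygy M n]}.
pose d n : {linear F n.+1 -> F n} := val \o free_cover (syzygy M n.+1).
have surj n y : exists x : F n, free_cover (syzygy M n) x = y.
  by exists << y >>; apply: malg_liftU.
have ex n (x : F n) : free_cover (syzygy M n) x = 0 <-> exists y, x = d n y.
  split=> [/lker_valP[z zx]|[y ->]]; last exact: lker_valK.
  by have [y yz] := surj n.+1 z; exists y; rewrite /d /= yz.
apply: (inhabits (@ProjResolution R M F d (free_cover M) _ _ _ _)) => //.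
- by move=> n; apply: malg_projective.
- exact: (surj 0%N).
- exact: (ex 0%N).
- move=> n x; rewrite -(ex n.+1); split=> e; first exact: val_inj.
  by rewrite -[LHS]/(val (free_cover (syzygy M n.+1) x)) [X in val X]e.
Qed.

End FreeResolution.

(** * Partial projective resolutions compute Ext *)

Section Comparison.
Variables (R : nzRingType) (M : lmodType R).

(** No exactness is built in, so that the same arguments serve full resolutions and complexes known
    only in low degrees. *)
Record augmented_seq := AugmentedSeq {
  aug_obj :> nat -> lmodType R;
  aug_diff : forall n, {linear aug_obj n.+1 -> aug_obj n};
  aug_map : {linear aug_obj 0%N -> M}
}.

Implicit Types B C D : augmented_seq.

Definition is_complex (C : augmented_seq) m :=
  (forall x, aug_map C (aug_diff C 0%N x) = 0) /\
  (forall n x, (n < m)%N -> aug_diff C n (aug_diff C n.+1 x) = 0).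

Definition is_exact (C : augmented_seq) m :=
  [/\ forall y, exists x, aug_map C x = y,
      forall x, aug_map C x = 0 -> exists y, x = aug_diff C 0%N y &
      forall n x, (n < m)%N -> aug_diff C n x = 0 -> exists y, x = aug_diff C n.+1 y].

Definition projective_upto (C : augmented_seq) m :=
  forall n, (n <= m)%N -> projective (C n).

Definition partial_resolution (C : augmented_seq) m :=
  [/\ projective_upto C m.+1, is_complex C m & is_exact C m].

(* [f] is the degree [n] component of a chain map over the identity of [M],
   defined in degrees at most [n]. *)
Fixpoint chain_component (C D : augmented_seq) n : {linear C n -> D n} -> Prop :=
  if n is n'.+1 return {linear C n -> D n} -> Prop then
    fun f => exists2 g : {linear C n' -> D n'}, chain_component g &
      forall x, aug_diff D n' (f x) = g (aug_diff C n' x)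
  else fun f => forall x, aug_map D (f x) = aug_map C x.

(** A homotopy at the single degree [n]: its maps need not match those of the neighbouring degrees,
    which is enough for cohomology in degree [n]. *)
Definition homotopic (C D : augmented_seq) n : (C n -> D n) -> (C n -> D n) -> Prop :=
  match n return (C n -> D n) -> (C n -> D n) -> Prop with
  | 0 => fun f g => exists h : {linear C 0%N -> D 1%N},
      forall x, f x - g x = aug_diff D 0%N (h x)
  | n'.+1 => fun f g => exists h : {linear C n'.+1 -> D n'.+2},
      exists k : {linear C n' -> D n'.+1},
      forall x, f x - g x = aug_diff D n'.+1 (h x) + k (aug_diff C n' x)
  end.

Lemma chain_component_extend C D m n (f : {linear C n -> D n}) :
  projective_upto C m.+1 -> is_complex C m -> is_exact D m ->
  (n <= m)%N -> chain_component f ->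
  exists2 g : {linear C n.+1 -> D n.+1}, chain_component g &
    forall x, aug_diff D n (g x) = f (aug_diff C n x).
Proof.
move=> prC [augC compC] [_ ex0 ex1] le_nm fP.
suff [g gE] : exists g : {linear C n.+1 -> D n.+1},
    forall x, aug_diff D n (g x) = f (aug_diff C n x).
  by exists g => //; exists f.
apply: (projective_lift (f := f \o aug_diff C n)) => [|x /=]; first exact: prC.
case: n f le_nm fP x => [|n] f le_nm fP x.
  have [|y ->] := ex0 (f (aug_diff C 0%N x)); last by exists y.
  by rewrite fP augC.
have [g _ gE] := fP.
have [||y ->] := ex1 n (f (aug_diff C n.+1 x)) => //; last by exists y.
by rewrite gE compC // linear0.
Qed.

Lemma chain_component_exists C D m n :
  projective_upto C m.+1 -> is_complex C m -> is_exact D m ->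
  (n <= m)%N -> exists f : {linear C n -> D n}, chain_component f.
Proof.
move=> prC cC exD; elim: n => [|n IH] le_nm.
  have [surj _ _] := exD.
  exact: (projective_lift (g := aug_map D) (f := aug_map C) (prC 0%N isT)).
have [f fP] := IH (ltnW le_nm).
by have [g gP _] := chain_component_extend prC cC exD (ltnW le_nm) fP; exists g.
Qed.

Lemma chain_component_homotopic C D m n (f g : {linear C n -> D n}) :
  projective_upto C m.+1 -> is_complex C m -> is_exact D m ->
  (n <= m)%N -> chain_component f -> chain_component g -> homotopic f g.
Proof.
move=> prC [augC compC] [_ ex0 ex1].
elim: n f g => [|n IH] f g le_nm fP gP.
  have [||h hE] := @projective_lift R _ _ _ (aug_diff D 0%N) (f \- g).
  - exact: prC.
  - move=> x /=; have [|y ->] := ex0 (f x - g x); last by exists y.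
    by rewrite linearB fP gP subrr.
  by exists h => x; rewrite hE.
have [f' fP' fE] := fP; have [g' gP' gE] := gP.
(* For [n > 0] the homotopy in degree [n] has a second term, through the differential of [C]. On
   boundaries it dies because d d = 0, and the remaining [h] corrects [f \- g] to a map into
   cycles. *)
have [h hE] : exists h : {linear C n -> D n.+1},
    forall x, f' (aug_diff C n x) - g' (aug_diff C n x) =
              aug_diff D n (h (aug_diff C n x)).
  case: n f' g' fP' gP' IH le_nm {f g fP gP fE gE}
    => [|n] f' g' fP' gP' IH le_nm.
    by have [h hE] := IH _ _ isT fP' gP'; exists h => x; apply: hE.
  have [h [k hE]] := IH _ _ (ltnW le_nm) fP' gP'.
  by exists h => x; rewrite hE compC ?linear0 ?addr0 // ltnW.
have [//||s sE] := @projective_lift R _ _ _ (aug_diff D n.+1)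
  ((f \- g) \- (h \o aug_diff C n)) (prC n.+1 _).
- exact: (leq_trans le_nm).
- move=> x /=; have [//||y ->] := ex1 n (f x - g x - h (aug_diff C n x)).
    by rewrite !linearB fE gE /= hE subrr.
  by exists y.
by exists s, h => x; rewrite sE /= subrK.
Qed.

Lemma chain_component_id C n : @chain_component C C n idfun.
Proof. by elim: n => [|n IH] //=; exists idfun. Qed.

Lemma chain_component_comp B C D n (f : {linear B n -> C n}) (g : {linear C n -> D n}) :
  chain_component f -> chain_component g -> chain_component (g \o f).
Proof.
elim: n f g => [|n IH] f g /=; first by move=> fP gP x; rewrite gP fP.
move=> [f' fP fE] [g' gP gE]; exists (g' \o f'); first exact: IH.
by move=> x /=; rewrite gE fE.
Qed.

End Comparison.

(** * Invariance of cohomology under change of partial resolution *)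

Section CohomologyTransfer.
Variables (K : fieldType) (R : algType K) (M N : lmodType R).
Implicit Types C D : augmented_seq M.

Definition aug_cocycle C n (f : C n -> N) := forall x, f (aug_diff C n x) = 0.

Definition aug_coboundary C n : (C n -> N) -> Prop :=
  match n with
  | 0%N => fun f => forall x, f x = 0
  | m.+1 => fun f => exists g : {linear C m -> N}, forall x, f x = g (aug_diff C m x)
  end.

Definition aug_cohomology_dim C n d : Prop :=
  exists z : 'I_d -> {linear C n -> N},
    (forall i, aug_cocycle (z i)) /\
    (forall f : {linear C n -> N}, aug_cocycle f ->
       exists! c : 'rV[K]_d, aug_coboundary (fun x => f x - \sum_i (c 0 i)%:A *: z i x)).

Lemma aug_coboundary_eq C n (f g : C n -> N) :
  f =1 g -> aug_coboundary f -> aug_coboundary g.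
Proof.
case: n f g => [|n] f g fg /=; first by move=> f0 x; rewrite -fg.
by case=> h hE; exists h => x; rewrite -fg.
Qed.

Lemma aug_coboundaryD C n (f g : C n -> N) :
  aug_coboundary f -> aug_coboundary g -> aug_coboundary (fun x => f x + g x).
Proof.
case: n f g => [|n] f g /=; first by move=> f0 g0 x; rewrite f0 g0 addr0.
by move=> [h hE] [k kE]; exists (h \+ k) => x; rewrite hE kE.
Qed.

(** The scalars of K are central in R, hence act on R-linear maps although R need not be
    commutative. *)
Lemma scaleAC (V : lmodType R) (a : K) (r : R) (v : V) :
  a%:A *: (r *: v) = r *: (a%:A *: v).
Proof. by rewrite !scalerA mulr_algl mulr_algr. Qed.

Lemma scaleA_linear (V W : lmodType R) (a : K) (f : {linear V -> W}) :
  linear (fun x => a%:A *: f x).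
Proof. by move=> r x y; rewrite linearP scalerDr scaleAC. Qed.

Lemma aug_coboundaryZ C n a (f : C n -> N) :
  aug_coboundary f -> aug_coboundary (fun x => a%:A *: f x).
Proof.
case: n f => [|n] f /=; first by move=> f0 x; rewrite f0 scaler0.
move=> [h hE]; have [k kE] := linear_of (scaleA_linear a h).
by exists k => x; rewrite kE hE.
Qed.

Lemma aug_coboundary_sum C n d (a : 'I_d -> K) (f : 'I_d -> C n -> N) :
  (forall i, aug_coboundary (f i)) ->
  aug_coboundary (fun x => \sum_i (a i)%:A *: f i x).
Proof.
move=> fP; suff H s : aug_coboundary (fun x => \sum_(i <- s) (a i)%:A *: f i x).
  exact: H.
elim: s => [|i s IH].
  apply: (@aug_coboundary_eq _ _ (fun=> 0)) => [x|]; first by rewrite big_nil.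
  by case: n f fP => [|n] _ _ //=; exists \0.
apply: (@aug_coboundary_eq _ _ (fun x => (a i)%:A *: f i x +
    \sum_(j <- s) (a j)%:A *: f j x)) => [x|]; first by rewrite big_cons.
by apply: aug_coboundaryD => //; apply: aug_coboundaryZ.
Qed.

Lemma cocycle_homotopic C n (z : {linear C n -> N}) (f g : C n -> C n) :
  aug_cocycle z -> homotopic f g ->
  aug_coboundary (fun x => z (f x) - z (g x)).
Proof.
case: n z f g => [|n] z f g zP /=.
  by move=> [h hE] x; rewrite -linearB hE zP.
move=> [h [k hE]]; exists (z \o k) => x /=.
by rewrite -linearB hE linearD zP add0r.
Qed.

Lemma aug_coboundary_comp C D n (f : D n -> N) (psi : {linear C n -> D n}) :
  chain_component psi -> aug_coboundary f -> aug_coboundary (fun x => f (psi x)).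
Proof.
case: n f psi => [|n] f psi /=; first by move=> _ f0 x; rewrite f0.
move=> [psi' _ psiE] [g gE]; exists (g \o psi') => x /=.
by rewrite gE psiE.
Qed.

(** Comparison maps [phi : D -> C] and [psi : C -> D] have composites homotopic to the identities,
    and a cocycle turns a homotopy into a coboundary. So the classes are pulled back along [phi],
    and the coordinates of a cocycle [f] are those of [f \o psi]. *)
Theorem cohomology_transfer C D m n d :
  partial_resolution C m -> partial_resolution D m -> (n <= m)%N ->
  aug_cohomology_dim C n d -> aug_cohomology_dim D n d.
Proof.
move=> [prC cC exC] [prD cD exD] le_nm [z [zP zE]].
have [phi phiP] := chain_component_exists prD cD exC le_nm.
(* The component in degree [n.+1] is what makes pullback along [phi] preserve cocycles. *)
have [phi' _ phiE] := chain_component_extend prD cD exC le_nm phiP.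
have [psi psiP] := chain_component_exists prC cC exD le_nm.
have [psi' _ psiE] := chain_component_extend prC cC exD le_nm psiP.
have hC := chain_component_homotopic prC cC exC le_nm
  (chain_component_comp psiP phiP) (chain_component_id C n).
have hD := chain_component_homotopic prD cD exD le_nm
  (chain_component_comp phiP psiP) (chain_component_id D n).
exists (fun i => z i \o phi); split=> [i x|f fP] /=; first by rewrite -phiE zP.
have [|c [cE cU]] := zE (f \o psi); first by move=> x /=; rewrite -psiE fP.
exists c; split=> [|c' c'E].
  have cob1 := aug_coboundary_comp phiP cE.
  have cob2 := aug_coboundaryZ (-1) (cocycle_homotopic fP hD).
  apply: aug_coboundary_eq (aug_coboundaryD cob1 cob2) => x /=.
  by rewrite !scaleN1r opprB addrC addrA subrK.
apply: cU; have cob1 := aug_coboundary_comp psiP c'E.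
have cob2 := aug_coboundary_sum (fun i => c' 0 i)
  (fun i => cocycle_homotopic (zP i) hC).
apply: aug_coboundary_eq (aug_coboundaryD cob1 cob2) => x /=.
rewrite -addrA; congr (_ + _).
under [X in _ + X]eq_bigr => i _ do rewrite scalerBr.
by rewrite sumrB addKr.
Qed.

End CohomologyTransfer.

Lemma Ext_dim_partial_resolution (K : fieldType) (R : algType K) (M N : lmodType R)
    (C : augmented_seq M) m n d :
  partial_resolution C m -> (n <= m)%N -> aug_cohomology_dim N C n d ->
  Ext_dim M N n d.
Proof.
move=> Cm le_nm dimC; split=> [|P]; first exact: free_resolution.
pose D := AugmentedSeq (res_diff P) (res_aug P).
suff Dm : partial_resolution D m by apply: (cohomology_transfer Cm Dm le_nm dimC).
split; first by move=> k _; apply: res_projective.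
- split=> [x|k x _] /=; first by apply/res_exact0; exists x.
  by apply/res_exact; exists x.
- split=> [||k x _] /=; first exact: res_aug_surj.
  + by move=> x /res_exact0.
  + by move=> /res_exact.
Qed.

(** * Linear maps given by tables *)

(* [s : comb I] stands for the formal sum of the [a.1 *+ a.2], [a] in [s]; the
   coefficients live in the prime field, so that equality of formal sums can be
   decided by computation whatever the ground field is. *)
Definition comb (I : Type) := seq (nat * I).

(** Substitution in a formal sum; on tables it is composition of linear maps, see [table_comp]. *)
Definition bind (I J : Type) (s : comb I) (T : I -> comb J) : comb J :=
  flatten [seq [seq (a.1 * b.1, b.2)%N | b <- T a.2] | a <- s].

Definition coef (I : eqType) (i : I) (s : comb I) : nat :=
  sumn [seq a.1 | a <- s & a.2 == i].

Definition comb_eq (p : nat) (I : eqType) (s t : comb I) : bool :=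
  all (fun a => coef a.2 s == coef a.2 t %[mod p]) (s ++ t).

(** Basis families are extended by zero outside [dom]. Cutting tables off there makes them correct
    at every index, so they compose without side conditions. *)
Definition comb_on (I J : Type) (dom : pred I) (T : I -> comb J) (i : I) : comb J :=
  if dom i then T i else [::].

Section Eval.
Variables (V : zmodType).

Definition ev (I : Type) (vec : I -> V) (s : comb I) : V :=
  \sum_(a <- s) vec a.2 *+ a.1.

Lemma ev_nil I (vec : I -> V) : ev vec [::] = 0.
Proof. exact: big_nil. Qed.

Lemma ev1 I (vec : I -> V) i : ev vec [:: (1%N, i)] = vec i.
Proof. by rewrite /ev big_seq1. Qed.

Lemma ev_cat I (vec : I -> V) s t : ev vec (s ++ t) = ev vec s + ev vec t.
Proof. exact: big_cat. Qed.

Lemma eq_ev I (vec vec' : I -> V) s : vec =1 vec' -> ev vec s = ev vec' s.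
Proof. by move=> e; apply: eq_bigr => a _; rewrite e. Qed.

Lemma ev_map I J (vec : J -> V) (f : I -> J) s :
  ev vec [seq (a.1, f a.2) | a <- s] = ev (vec \o f) s.
Proof. by rewrite /ev big_map. Qed.

Lemma ev_bind I J (vec : J -> V) (s : comb I) T :
  ev vec (bind s T) = ev (fun i => ev vec (T i)) s.
Proof.
rewrite /ev /bind big_flatten big_map; apply: eq_bigr => a _.
rewrite big_map -sumrMnl; apply: eq_bigr => b _ /=.
by rewrite mulnC mulrnA.
Qed.

Lemma ev_coef (I : eqType) (vec : I -> V) (s : comb I) (U : seq I) :
  uniq U -> {subset [seq a.2 | a <- s] <= U} ->
  ev vec s = \sum_(i <- U) vec i *+ coef i s.
Proof.
move=> uU; elim: s => [|a s IH] sub.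
  by rewrite ev_nil big1 // => i _; rewrite mulr0n.
rewrite /ev big_cons -/(ev _ _) IH => [|i si]; last by apply: sub; rewrite inE si orbT.
have aU : a.2 \in U by apply: sub; rewrite mem_head.
rewrite (big_rem _ aU) [RHS](big_rem _ aU) /= addrA; congr (_ + _).
  by rewrite /coef /= eqxx /= mulrnDr.
apply: eq_big_seq => i; rewrite mem_rem_uniq // inE => /andP[ia _].
by rewrite /coef /= eq_sym (negbTE ia).
Qed.

Lemma comb_eq_ev (p : nat) (I : eqType) (vec : I -> V) (s t : comb I) :
  (forall v : V, v *+ p = 0) -> comb_eq p s t -> ev vec s = ev vec t.
Proof.
move=> pV /allP st; set U := undup [seq a.2 | a <- s ++ t].
have [uU memU] : uniq U /\ {subset [seq a.2 | a <- s ++ t] <= U}.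
  by rewrite undup_uniq; split=> // i; rewrite mem_undup.
rewrite (ev_coef _ uU) => [|i si]; last by apply: memU; rewrite map_cat mem_cat si.
rewrite (ev_coef vec uU) => [|i si]; last by apply: memU; rewrite map_cat mem_cat si orbT.
apply: eq_big_seq => i; rewrite mem_undup => /mapP[a /st /eqP e ->].
have modp v k : v *+ k = v *+ (k %% p) :> V.
  by rewrite {1}(divn_eq k p) mulrnDr mulnC mulrnA pV mul0rn add0r.
by rewrite modp e -modp.
Qed.

End Eval.

Lemma ev_additive (V W : zmodType) (f : {additive V -> W}) I (vec : I -> V) s :
  f (ev vec s) = ev (f \o vec) s.
Proof. by rewrite raddf_sum; apply: eq_bigr => a _; rewrite raddfMn. Qed.

Lemma ev_ffun (V : zmodType) (L : finType) I (vec : I -> {ffun L -> V}) s l :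
  ev vec s l = ev (fun i => vec i l) s.
Proof. by rewrite /ev sum_ffunE; apply: eq_bigr => a _; rewrite ffunMnE. Qed.

Section FreeOn.
Variable K : fieldType.
Implicit Types V W : lmodType K.

(* The [vec i] with [dom i] form a basis of V (stated as a universal property),
   the other ones are zero. *)
Record free_on V (I : Type) (dom : pred I) (vec : I -> V) : Prop := FreeOn {
  free_out : forall i, ~~ dom i -> vec i = 0;
  free_ext : forall W (T : I -> W),
    exists f : {linear V -> W}, forall i, dom i -> f (vec i) = T i;
  free_uniq : forall W (f g : {linear V -> W}),
    (forall i, dom i -> f (vec i) = g (vec i)) -> f =1 g }.

Lemma free_table V W I J (dom : pred I) (vec : I -> V) (vec' : J -> W)
    (T : I -> comb J) : free_on dom vec ->
  exists f : {linear V -> W}, forall i, f (vec i) = ev vec' (comb_on dom T i).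
Proof.
move=> [out ext _]; have [f fE] := ext W (fun i => ev vec' (T i)).
exists f => i; rewrite /comb_on; case: ifPn => [|/out->]; first exact: fE.
by rewrite linear0 ev_nil.
Qed.

(** The bridge from computation to proof: agreement on a basis is tested on a finite list [keys],
    and multiples of [p] vanish in any vector space over K. *)
Lemma free_eqP (p : nat) V W (I J : eqType) (dom : pred I) (vec : I -> V)
    (vec' : J -> W) (f g : {linear V -> W}) T T' (keys : seq I) :
  p \in [pchar K] -> free_on dom vec ->
  (forall i, f (vec i) = ev vec' (T i)) -> (forall i, g (vec i) = ev vec' (T' i)) ->
  (forall i, dom i -> i \in keys) ->
  all (fun i => comb_eq p (T i) (T' i)) keys -> f =1 g.
Proof.
move=> pK [_ _ uni] fE gE mem /allP eqT; apply: uni => i di.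
rewrite fE gE; apply: (@comb_eq_ev _ p); last exact/eqT/mem.
by move=> v; rewrite -scaler_nat pcharf0 ?scale0r.
Qed.

Lemma table_comp V W (X : lmodType K) I J L (vec : I -> V) (vec' : J -> W) (vec'' : L -> X)
    (f : {linear V -> W}) (g : {linear W -> X}) T T' :
  (forall i, f (vec i) = ev vec' (T i)) -> (forall j, g (vec' j) = ev vec'' (T' j)) ->
  forall i, (g \o f) (vec i) = ev vec'' (bind (T i) T').
Proof.
by move=> fE gE i /=; rewrite fE ev_additive ev_bind; apply: eq_ev => j /=.
Qed.

Definition row_vec n (i : nat) : 'rV[K]_n := \row_j ((j : nat) == i)%:R.

Lemma row_vecE n (i : 'I_n) : row_vec n i = delta_mx 0 i.
Proof. by apply/rowP => j; rewrite !mxE. Qed.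

Lemma free_row n : free_on (fun i => i < n)%N (row_vec n).
Proof.
split=> [i|W T|W f g fg v].
- rewrite -leqNgt => le_ni; apply/rowP => j; rewrite !mxE.
  by rewrite ltn_eqF // (leq_trans (ltn_ord j)).
- have [f fE] : exists f : {linear 'rV[K]_n -> W}, forall v, f v = \sum_i v 0 i *: T i.
    apply: linear_of => a u v; rewrite scaler_sumr -big_split; apply: eq_bigr => i _ /=.
    by rewrite !mxE scalerDl scalerA.
  exists f => i lt_in; rewrite fE (bigD1 (Ordinal lt_in)) //= big1 => [|j].
    by rewrite mxE eqxx scale1r addr0.
  by rewrite -val_eqE => /negbTE /= nj; rewrite mxE nj scale0r.
- rewrite [v]row_sum_delta !linear_sum; apply: eq_bigr => i _.
  by rewrite !linearZ -row_vecE fg.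
Qed.

Section FiniteFunction.
Variables (X : lmodType K) (I : Type) (dom : pred I) (vec : I -> X) (k : nat).

Definition ffun_dom (a : nat * I) := (a.1 < k)%N && dom a.2.

Definition ffun_vec (a : nat * I) : {ffun 'I_k -> X} :=
  [ffun l : 'I_k => if (l : nat) == a.1 then vec a.2 else 0].

Lemma ffun_vec_sum (v : {ffun 'I_k -> X}) :
  v = \sum_l [ffun j : 'I_k => if j == l then v l else 0].
Proof.
apply/ffunP => j; rewrite sum_ffunE (bigD1 j) //= ffunE eqxx big1 ?addr0 // => l nl.
by rewrite ffunE eq_sym (negbTE nl).
Qed.

Lemma free_ffun : free_on dom vec -> free_on ffun_dom ffun_vec.
Proof.
case=> out ext uni; split=> [[j i]|W T|W f g fg v].
- rewrite negb_and /= => /orP ji; apply/ffunP => l; rewrite !ffunE /=.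
  case: ji => [|ni]; last by rewrite out ?if_same.
  by rewrite -leqNgt => le_kj; rewrite ltn_eqF // (leq_trans (ltn_ord l)).
- have [F FE] := fin_all_exists (fun l : 'I_k => ext W (fun i => T (l : nat, i))).
  have [f fE] : exists f : {linear {ffun 'I_k -> X} -> W}, forall v, f v = \sum_l F l (v l).
    apply: linear_of => a u v; rewrite scaler_sumr -big_split; apply: eq_bigr => l _ /=.
    by rewrite !ffunE linearP.
  exists f => -[j i] /andP[/= lt_jk di].
  rewrite fE (bigD1 (Ordinal lt_jk)) //= big1 => [|l].
    by rewrite ffunE eqxx FE // addr0.
  by rewrite -val_eqE => /negbTE /= nl; rewrite ffunE nl linear0.
- rewrite [v]ffun_vec_sum !linear_sum; apply: eq_bigr => l _.
  have [h hE] : exists h : {linear X -> {ffun 'I_k -> X}},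
      forall x, h x = [ffun j : 'I_k => if j == l then x else 0].
    apply: linear_of => a x y; apply/ffunP => j; rewrite !ffunE.
    by case: ifP => _ //; rewrite scaler0 addr0.
  rewrite -hE; apply: (uni _ (f \o h) (g \o h)) => i di /=.
  have -> : h (vec i) = ffun_vec (l : nat, i).
    by rewrite hE; apply/ffunP => j; rewrite !ffunE.
  by apply: fg; rewrite /ffun_dom ltn_ord.
Qed.

End FiniteFunction.

Section EnvelopingBasis.
Variables (A : falgType K) (n : nat) (bas : nat -> A).

Definition env_dom (a : nat * nat) := (a.1 < n)%N && (a.2 < n)%N.

(* The element [x (x) y] of the bimodule [A (x) A] is an element of the left
   module [A^op (x) A], hence the exchange. *)
Definition env_vec (a : nat * nat) : enveloping A := tens (bas a.2) (bas a.1).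

Lemma free_enveloping :
  free_on (fun i => i < n)%N bas -> free_on env_dom env_vec.
Proof.
case=> out ext uni; split=> [[x y]|W T|W f g fg].
- rewrite /env_vec negb_and /= => /orP[] /out ->; first exact: linear0.
  by rewrite -/(tensl _ 0) linear0.
(* [c] gives the coordinates in [bas]; [F] is then the bilinear map with the prescribed values on
   pairs of basis vectors, in the exchanged order of [env_vec]. *)
- have [c cE] := ext _ (row_vec n).
  pose F a b := \sum_(x < n) \sum_(y < n) (c a 0 y * c b 0 x) *: T (x : nat, y : nat).
  have Fl b : linear (F^~ b).
    move=> t u v; rewrite /F scaler_sumr -big_split; apply: eq_bigr => x _ /=.
    rewrite scaler_sumr -big_split; apply: eq_bigr => y _ /=.
    by rewrite linearP !mxE mulrDl scalerDl -mulrA scalerA.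
  have Fr a : linear (F a).
    move=> t u v; rewrite /F scaler_sumr -big_split; apply: eq_bigr => x _ /=.
    rewrite scaler_sumr -big_split; apply: eq_bigr => y _ /=.
    by rewrite linearP !mxE mulrDr scalerDl mulrCA scalerA.
  exists (env_lift F) => -[x y] /andP[/= xn yn].
  rewrite env_lift_tens // /F !cE //=.
  rewrite (bigD1 (Ordinal xn)) //= (bigD1 (Ordinal yn)) //= !mxE !eqxx mulr1 scale1r.
  rewrite !big1 ?addr0 // => [i|j]; last first.
    by rewrite -val_eqE => /negbTE /= nj; rewrite !mxE nj mul0r scale0r.
  rewrite -val_eqE => /negbTE /= ni; rewrite big1 // => j _.
  by rewrite !mxE ni mulr0 scale0r.
- apply: env_ext => a b.
  have E x : (x < n)%N -> f (tens (bas x) b) = g (tens (bas x) b).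
    move=> xn; apply: (uni _ (f \o tens (bas x)) (g \o tens (bas x))) => y yn /=.
    by apply: (fg (y, x)); rewrite /env_dom yn.
  exact: (uni _ (f \o tensl b) (g \o tensl b)).
Qed.

End EnvelopingBasis.
End FreeOn.

(** * Modules over the enveloping algebra *)

Section FreeModules.
Variables (K : fieldType) (A : falgType K).
Local Notation R := (enveloping A).
Implicit Types (k n : nat).

(** Right multiplication by the matrix with rows [w i], hence left R-linear. *)
Definition rmul k k' (w : nat -> {ffun 'I_k' -> R}) (x : {ffun 'I_k -> R}) :
    {ffun 'I_k' -> R} :=
  [ffun l => \sum_i x i * w i l].

(** The transpose of [rmul w] under Hom_R(R^k, A) = A^k, see [pairing_amul]. *)
Definition amul k k' (w : nat -> {ffun 'I_k' -> R}) (v : {ffun 'I_k' -> A}) :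
    {ffun 'I_k -> A} :=
  [ffun i : 'I_k => \sum_l env_act (w i l) (v l)].

Lemma rmul_linearK k k' w : linear (@rmul k k' w).
Proof.
move=> a x y; apply/ffunP => l; rewrite !ffunE scaler_sumr -big_split.
by apply: eq_bigr => i _; rewrite !ffunE mulrDl scalerAl.
Qed.

Lemma rmul_linearR k k' w :
  linear (@rmul k k' w : {ffun 'I_k -> R^o} -> {ffun 'I_k' -> R^o}).
Proof.
move=> a x y; apply/ffunP => l; rewrite !ffunE scaler_sumr -big_split.
by apply: eq_bigr => i _; rewrite !ffunE mulrDl; congr (_ + _); apply/esym/mulrA.
Qed.

Lemma amul_linear k k' w : linear (@amul k k' w).
Proof.
move=> a x y; apply/ffunP => l; rewrite !ffunE scaler_sumr -big_split.
by apply: eq_bigr => i _; rewrite !ffunE env_act_is_linear.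
Qed.

(** The same function gets two linear structures: over K, to be determined by tables on a basis, and
    over R, to be a map of the modules in a resolution. *)
Definition rmulK k k' w : {linear {ffun 'I_k -> R} -> {ffun 'I_k' -> R}} :=
  HB.pack_for {linear {ffun 'I_k -> R} -> {ffun 'I_k' -> R}} (@rmul k k' w)
    (GRing.isLinear.Build K {ffun 'I_k -> R} {ffun 'I_k' -> R} _
      (@rmul k k' w) (@rmul_linearK k k' w)).

Definition rmulR k k' w : {linear {ffun 'I_k -> R^o} -> {ffun 'I_k' -> R^o}} :=
  HB.pack_for {linear {ffun 'I_k -> R^o} -> {ffun 'I_k' -> R^o}} (@rmul k k' w)
    (GRing.isLinear.Build R {ffun 'I_k -> R^o} {ffun 'I_k' -> R^o} _
      (@rmul k k' w) (@rmul_linearR k k' w)).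

HB.instance Definition _ k k' w :=
  GRing.isLinear.Build K {ffun 'I_k' -> A} {ffun 'I_k -> A} _
    (@amul k k' w) (@amul_linear k k' w).

Lemma env_scaleA (a : K) (x : env_module A) : a%:A *: x = a *: (x : A) :> A.
Proof.
rewrite -[LHS]/(env_act (a *: env_one A) x) /env_act linearZ /=.
by rewrite -[env_lift _ _]/(env_act (tens 1 1) x) env_act_tens mul1r mulr1.
Qed.

(** Evaluation at [x] of the R-linear map R^k -> A that corresponds to [v]. *)
Definition pairing k (v : {ffun 'I_k -> A}) (x : {ffun 'I_k -> R}) : env_module A :=
  \sum_i env_act (x i) (v i).

Lemma pairing_linear k v : linear (@pairing k v : {ffun 'I_k -> R^o} -> _).
Proof.
move=> a x y; rewrite scaler_sumr -big_split; apply: eq_bigr => i _ /=.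
by rewrite !ffunE env_actDl -env_actA.
Qed.

Lemma pairing_linearK k v : linear (@pairing k v : {ffun 'I_k -> R} -> A).
Proof.
move=> a x y; rewrite scaler_sumr -big_split; apply: eq_bigr => i _ /=.
by rewrite !ffunE /env_act linearP.
Qed.

Lemma pairing_linearl k (x : {ffun 'I_k -> R}) :
  linear (fun v => pairing v x : A).
Proof.
move=> a u v; rewrite scaler_sumr -big_split; apply: eq_bigr => i _ /=.
by rewrite !ffunE env_act_is_linear.
Qed.

Definition pairingR k v : {linear {ffun 'I_k -> R^o} -> env_module A} :=
  HB.pack_for {linear {ffun 'I_k -> R^o} -> env_module A} (@pairing k v)
    (GRing.isLinear.Build R {ffun 'I_k -> R^o} (env_module A) _
      (@pairing k v) (@pairing_linear k v)).

Definition pairingK k v : {linear {ffun 'I_k -> R} -> A} :=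
  HB.pack_for {linear {ffun 'I_k -> R} -> A} (@pairing k v)
    (GRing.isLinear.Build K {ffun 'I_k -> R} A _
      (@pairing k v) (@pairing_linearK k v)).

Lemma pairing_amul k k' (w : nat -> {ffun 'I_k' -> R}) v (x : {ffun 'I_k -> R}) :
  pairing (amul k w v) x = pairing v (rmul w x).
Proof.
rewrite /pairing.
under eq_bigr => i _ do rewrite ffunE -[env_act _ _]/(x i *: (_ : env_module A)) scaler_sumr.
rewrite exchange_big; apply: eq_bigr => l _ /=.
rewrite ffunE -[RHS]/(_ *: (v l : env_module A)) scaler_suml.
by apply: eq_bigr => i _; rewrite -scalerA.
Qed.

Definition unit_vec k (i : 'I_k) : {ffun 'I_k -> R} := [ffun j => (j == i)%:R].

Lemma unit_vec_sum k (x : {ffun 'I_k -> R^o}) :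
  x = \sum_i x i *: (unit_vec i : {ffun 'I_k -> R^o}).
Proof.
apply/ffunP => j; rewrite sum_ffunE (bigD1 j) //= big1 => [|i /negbTE ni].
  by rewrite addr0 ffunE ffunE eqxx; apply/esym/mulr1.
by rewrite ffunE ffunE eq_sym ni; apply: mulr0.
Qed.

Lemma linear_unit_vec k (V : lmodType R) (f : {linear {ffun 'I_k -> R^o} -> V}) x :
  f x = \sum_i x i *: f (unit_vec i).
Proof. by rewrite {1}[x]unit_vec_sum linear_sum; apply: eq_bigr => i _; rewrite linearZ. Qed.

Lemma ffun_projective k : projective {ffun 'I_k -> R^o}.
Proof.
move=> U V g f surj.
have [u uE] := fin_all_exists (fun i : 'I_k => surj (f (unit_vec i))).
have [h hE] : exists h : {linear {ffun 'I_k -> R^o} -> U}, forall x, h x = \sum_i x i *: u i.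
  apply: linear_of => a x y; rewrite scaler_sumr -big_split; apply: eq_bigr => i _ /=.
  by rewrite !ffunE scalerDl scalerA.
exists h => x; rewrite hE linear_sum [RHS]linear_unit_vec; apply: eq_bigr => i _.
by rewrite linearZ uE.
Qed.

Lemma rmul_unit_vec k k' (w : nat -> {ffun 'I_k' -> R}) (i : 'I_k) :
  rmul w (unit_vec i) = w i.
Proof.
apply/ffunP => l; rewrite ffunE (bigD1 i) //= big1 => [|j nj].
  by rewrite ffunE eqxx mul1r addr0.
by rewrite ffunE (negbTE nj) mul0r.
Qed.

End FreeModules.

(* A direct summand of a module is the kernel of [x |-> e x - x], [e] being the
   idempotent. *)
Section Summand.
Variables (R : nzRingType) (P : lmodType R) (e : {linear P -> P}).
Hypothesis e_idem : forall x, e (e x) = e x.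

Definition summand : lmodType R := lker_type (e \- idfun).

Lemma summandE (x : summand) : e (val x) = val x.
Proof. by have /eqP := lker_valK x; rewrite subr_eq0 => /eqP. Qed.

Fact summand_subproof x : e x \in lker_pred (e \- idfun).
Proof. by rewrite inE /= e_idem subrr. Qed.

Definition to_summand_fun x : summand := LKer (summand_subproof x).

Fact to_summand_linear : linear to_summand_fun.
Proof. by move=> a x y; apply: val_inj; rewrite /= linearP. Qed.

HB.instance Definition _ :=
  GRing.isLinear.Build R P summand _ to_summand_fun to_summand_linear.
Definition to_summand : {linear P -> summand} := to_summand_fun.

Lemma val_to_summand x : val (to_summand x) = e x. Proof. by []. Qed.

Lemma to_summand_val x : to_summand (val x) = x.
Proof. by apply: val_inj; rewrite val_to_summand summandE. Qed.

Lemma summand_projective : projective P -> projective summand.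
Proof.
move=> projP U V g f surj; have [h hE] := projP _ _ g (f \o to_summand) surj.
by exists (h \o val) => x; rewrite /= hE /= to_summand_val.
Qed.

End Summand.

(** * Resolutions and cohomology from tables *)

Definition table (I J : Type) := seq (I * comb J).

Definition lookup (I : eqType) J (t : table I J) (i : I) : comb J :=
  oapp snd [::] (ohead [seq a <- t | a.1 == i]).

(* [(j, (x, y))] stands for the element [x (x) y] of the [j]-th summand of
   a direct sum of bimodules [A e (x) f A]. *)
Local Notation bikey := (nat * (nat * nat))%type.
Local Notation key := (nat * nat)%type.

(* The basis of A is numbered, by position in the list of words. [rd_gens] lists, for each
   degree, the pairs of idempotents (e, f) that define the summands A e (x) f A, and
   [rd_diff] the images of the generators e (x) f in the previous degree. [rd_unit] is a
   linear section of the augmentation; the entry (j, x) of [rd_htp] is the image of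
   x (x) f in the [j]-th summand under the contracting homotopy, which commutes with the
   right action of A. *)
Record resolution_data := ResolutionData {
  rd_dim : nat;
  rd_mul : seq (seq (comb nat));
  rd_gens : seq (seq (nat * nat));
  rd_diff : seq (seq (comb bikey));
  rd_unit : table nat bikey;
  rd_htp : seq (table key bikey)
}.

Definition same_tables (p : nat) (I J : eqType) (s : seq I) (T T' : I -> comb J) : bool :=
  all (fun i => comb_eq p (T i) (T' i)) s.

Definition tmult (t : seq (seq (comb nat))) (x y : nat) : comb nat :=
  nth [::] (nth [::] t x) y.

Section Tables.
Local Open Scope nat_scope.
Variable rd : resolution_data.
Local Notation N := (rd_dim rd).

Definition rmult := tmult (rd_mul rd).

(** The outer bimodule structure: a1 (x) a2 takes b1 (x) b2 to a1 b1 (x) b2 a2. *)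
Definition env_mult (a b : nat * nat) : comb (nat * nat) :=
  bind (rmult a.1 b.1) (fun x => [seq (c.1, (x, c.2)) | c <- rmult b.2 a.2]).

Definition rank n := size (nth [::] (rd_gens rd) n).

Definition idem n (i : nat) : comb bikey :=
  if i < rank n then [:: (1, (i, nth (0, 0) (nth [::] (rd_gens rd) n) i))] else [::].

Definition gen_diff n (i : nat) : comb bikey := nth [::] (nth [::] (rd_diff rd) n) i.

(** The augmentation is the multiplication of A; in degree 0 the two idempotents of a generator
    coincide in the data below, so e (x) e goes to e. *)
Definition gen_aug (i : nat) : comb nat :=
  if i < rank 0 then [:: (1, (nth (0, 0) (nth [::] (rd_gens rd) 0) i).1)] else [::].

Definition mul_table k (w : nat -> comb bikey) (a : bikey) : comb bikey :=
  if a.1 < k then bind (w a.1) (fun b => [seq (c.1, (b.1, c.2)) | c <- env_mult a.2 b.2])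
  else [::].

Definition act_table (a : nat * nat) (x : nat) : comb nat :=
  bind (rmult a.1 x) (fun y => rmult y a.2).

Definition dual_table k k' (w : nat -> comb bikey) (a : key) : comb key :=
  if a.1 < k' then
    flatten [seq [seq (c.1, (i, c.2)) | c <- bind (w i) (fun b =>
      if b.1 == a.1 then act_table b.2 a.2 else [::])] | i <- iota 0 k]
  else [::].

Definition pair_table k (v : nat -> comb nat) (a : bikey) : comb nat :=
  if a.1 < k then bind (v a.1) (act_table a.2) else [::].

Definition idem_table n := mul_table (rank n) (idem n).
Definition diff_table n := mul_table (rank n.+1) (gen_diff n).
Definition aug_table := pair_table (rank 0) gen_aug.

Definition dom k : pred bikey := ffun_dom (env_dom N) k.

Definition unit_table : nat -> comb bikey :=
  comb_on (fun x => x < N) (lookup (rd_unit rd)).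

Definition htp_table n : bikey -> comb bikey :=
  comb_on (dom (rank n)) (fun a =>
    bind (lookup (nth [::] (rd_htp rd) n) (a.1, a.2.1)) (fun b =>
      [seq (c.1, (b.1, (b.2.1, c.2))) | c <- rmult b.2.2 a.2.2])).

Definition bikeys k : seq bikey :=
  [seq (i, a) | i <- iota 0 k, a <- [seq (x, y) | x <- iota 0 N, y <- iota 0 N]].

Definition keys k : seq key := [seq (i, x) | i <- iota 0 k, x <- iota 0 N].

(** All identities are tested on the ambient free modules. In the contraction d h + h d =
    idempotent, the section of the augmentation serves as h in degree -1. Past the listed degrees
    the ranks are 0. *)
Definition resolution_check p m : bool :=
  [&& all (fun n => same_tables p (bikeys (rank n))
        (fun a => bind (idem_table n a) (idem_table n)) (idem_table n))
        (iota 0 (size (rd_gens rd))),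
      all (fun n => [&& same_tables p (bikeys (rank n.+1))
             (fun a => bind (idem_table n.+1 a) (diff_table n)) (diff_table n),
           same_tables p (bikeys (rank n.+1))
             (fun a => bind (diff_table n a) (idem_table n)) (diff_table n) &
           same_tables p (bikeys (rank n))
             (fun a => bind (htp_table n a) (diff_table n) ++
                       if n is n'.+1 then bind (diff_table n' a) (htp_table n')
                       else bind (aug_table a) unit_table)
             (idem_table n)]) (iota 0 m.+1),
      all (fun n => same_tables p (bikeys (rank n.+2))
        (fun a => bind (diff_table n.+1 a) (diff_table n)) (fun=> [::])) (iota 0 m),
      same_tables p (bikeys (rank 1))
        (fun a => bind (diff_table 0 a) aug_table) (fun=> [::]),
      same_tables p (bikeys (rank 0))
        (fun a => bind (idem_table 0 a) aug_table) aug_table &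
      same_tables p (iota 0 N)
        (fun x => bind (unit_table x) aug_table) (fun x => [:: (1, x)])].

(** [cd_prev] and [cd_next] act as partial inverses of the differentials into and out of the degree
    considered. *)
Record cohomology_data := CohomologyData {
  cd_cls : seq (comb key);
  cd_coord : table key nat;
  cd_prev : table key key;
  cd_next : table key key
}.

Definition codiff_table n := dual_table (rank n.+1) (rank n) (gen_diff n).

Definition coprev_table n : key -> comb key :=
  if n is n'.+1 then codiff_table n' else fun=> [::].

Definition coidem_table n := dual_table (rank n) (rank n) (idem n).

Definition kdom k : pred key := ffun_dom (fun x => x < N) k.

Definition cls_table cd := comb_on (fun i => i < size (cd_cls cd)) (nth [::] (cd_cls cd)).
Definition coord_table n cd := comb_on (kdom (rank n)) (lookup (cd_coord cd)).
Definition prev_table n cd := comb_on (kdom (rank n)) (lookup (cd_prev cd)).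
Definition next_table n cd := comb_on (kdom (rank n.+1)) (lookup (cd_next cd)).

(* The idempotent endomorphism of the cochain space, whose image is
   the space of degree [n] cochains, splits as
   (classes) o (coordinates) + (coboundary) o prev + next o (codifferential). *)
Definition cohomology_check p n cd : bool :=
  [&& same_tables p (keys (rank n)) (coidem_table n) (fun a =>
        bind (coord_table n cd a) (cls_table cd) ++
        bind (prev_table n cd a) (coprev_table n) ++
        bind (codiff_table n a) (next_table n cd)),
      same_tables p (keys (rank n.-1))
        (fun a => bind (coprev_table n a) (coord_table n cd)) (fun=> [::]),
      same_tables p (iota 0 (size (cd_cls cd)))
        (fun i => bind (cls_table cd i) (coord_table n cd)) (fun i => [:: (1, i)]),
      same_tables p (iota 0 (size (cd_cls cd)))
        (fun i => bind (cls_table cd i) (coidem_table n)) (cls_table cd) &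
      same_tables p (iota 0 (size (cd_cls cd)))
        (fun i => bind (cls_table cd i) (codiff_table n)) (fun=> [::])].

End Tables.

Section Resolution.
Variables (K : fieldType) (A : falgType K) (p : nat) (rd : resolution_data).
Variable bas : nat -> A.
Hypothesis pK : p \in [pchar K].
Local Notation N := (rd_dim rd).
Local Notation R := (enveloping A).
Hypothesis bas_free : free_on (fun x => x < N)%N bas.
Hypothesis basM : forall x y, bas x * bas y = ev bas (rmult rd x y).

Local Notation rvec k := (ffun_vec (env_vec bas) k).
Local Notation avec k := (ffun_vec bas k).

Let rvec_free k : free_on (dom rd k) (rvec k).
Proof. exact/free_ffun/free_enveloping. Qed.

Let avec_free k : free_on (ffun_dom (fun x => x < N)%N k) (avec k).
Proof. exact/free_ffun. Qed.

Lemma mem_bikeys k a : dom rd k a -> a \in bikeys rd k.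
Proof.
case: a => i [x y] /andP[/= ik /andP[/= xN yN]].
by apply: allpairs_f; [|apply: allpairs_f]; rewrite mem_iota add0n.
Qed.

Lemma mem_keys k a : ffun_dom (fun x => x < N)%N k a -> a \in keys rd k.
Proof.
case: a => i x /andP[/= ik xN].
by apply: allpairs_f; rewrite mem_iota add0n.
Qed.

Lemma env_vecM a b : env_vec bas a * env_vec bas b = ev (env_vec bas) (env_mult rd a b).
Proof.
rewrite -[LHS]/(env_mul _ _) env_mul_tens !basM ev_bind ev_additive.
apply: eq_ev => x /=; rewrite -[LHS]/(tensl _ _) ev_additive ev_map.
exact: eq_ev.
Qed.

Lemma env_vec_act a x : env_act (env_vec bas a) (bas x) = ev bas (act_table rd a x).
Proof.
rewrite env_act_tens basM ev_bind /ev mulr_suml; apply: eq_bigr => b _.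
by rewrite mulrnAl basM.
Qed.

Lemma rmul_vec k k' w a :
  rmul (fun i => ev (rvec k') (w i)) (rvec k a) = ev (rvec k') (mul_table rd k w a).
Proof.
rewrite /mul_table; case: ifPn => [ak|]; last first.
  rewrite -leqNgt => ka.
  have -> : rvec k a = 0.
    by apply: (free_out (rvec_free k)); rewrite /dom /ffun_dom ltnNge ka.
  by rewrite -[LHS]/(rmulK _ _ 0) linear0 ev_nil.
have rvecE k1 b (l : 'I_k1) :
    rvec k1 b l = if (l : nat) == b.1 then env_vec bas b.2 else 0 by rewrite ffunE.
apply/ffunP => l; rewrite ev_ffun ev_bind ffunE (bigD1 (Ordinal ak)) //= big1 => [|i].
  rewrite rvecE eqxx addr0 ev_ffun mulr_sumr; apply: eq_bigr => b _.
  rewrite mulrnAr ev_map rvecE; congr (_ *+ _); case: ifPn => lb.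
    by rewrite env_vecM; apply: eq_ev => c; rewrite /= rvecE lb.
  by rewrite mulr0 /ev big1 // => c _; rewrite /= rvecE (negbTE lb) mul0rn.
by rewrite -val_eqE rvecE => /negbTE /= ->; rewrite mul0r.
Qed.

Lemma amul_vec k k' w a :
  amul k (fun i => ev (rvec k') (w i)) (avec k' a) = ev (avec k) (dual_table rd k k' w a).
Proof.
rewrite /dual_table; case: ifPn => [ak|]; last first.
  rewrite -leqNgt => ka; have -> : avec k' a = 0.
    by apply: (free_out (avec_free k')); rewrite /ffun_dom ltnNge ka.
  by rewrite linear0 ev_nil.
have avecE k1 b (l : 'I_k1) :
    avec k1 b l = if (l : nat) == b.1 then bas b.2 else 0 by rewrite ffunE.
apply/ffunP => i; rewrite ev_ffun ffunE (bigD1 (Ordinal ak)) //= big1 => [|l]; last first.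
  rewrite -val_eqE avecE => /negbTE /= ->.
  by rewrite -[LHS]/(_ *: (0 : env_module A)) scaler0.
rewrite avecE eqxx addr0 ev_ffun.
(* In a concatenation of blocks indexed by [j], only the blocks with [j = i] reach the coordinate
   [i]. *)
have -> s (F : nat -> comb nat) :
    ev (fun j => avec k j i) (flatten [seq [seq (c.1, (j, c.2)) | c <- F j] | j <- s]) =
    \sum_(j <- s) if (i : nat) == j then ev bas (F j) else 0.
  rewrite /ev big_flatten big_map; apply: eq_bigr => j _; rewrite big_map /=.
  case: ifPn => ij; first by apply: eq_bigr => c _; rewrite avecE /= ij.
  by rewrite big1 // => c _; rewrite avecE /= (negbTE ij) mul0rn.
rewrite -big_mkcond (big_rem (i : nat)) ?mem_iota ?add0n ?ltn_ord //= eqxx.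
rewrite big1_seq ?addr0 => [|j /andP[/eqP ->]]; last first.
  by rewrite mem_rem_uniq ?iota_uniq // inE eqxx.
have actl x : zmod_morphism (fun r : R => env_act r x : A).
  by move=> r s; rewrite /env_act linearB.
pose act x := HB.pack_for {additive R -> A} (fun r => env_act r x : A)
  (GRing.isZmodMorphism.Build R A (fun r => env_act r x : A) (actl x)).
rewrite -[LHS]/(act (bas a.2) _) ev_additive ev_bind; apply: eq_ev => b.
rewrite /= ffunE eq_sym; case: ifPn => _; first exact: env_vec_act.
by rewrite ev_nil -[LHS]/(act (bas a.2) 0) raddf0.
Qed.

Lemma pairing_vec k (v : nat -> comb nat) a :
  pairing [ffun i : 'I_k => ev bas (v i)] (rvec k a) = ev bas (pair_table rd k v a).
Proof.
rewrite /pair_table; case: ifPn => [ak|]; last first.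
  rewrite -leqNgt => ka; have -> : rvec k a = 0.
    by apply: (free_out (rvec_free k)); rewrite /dom /ffun_dom ltnNge ka.
  by rewrite -[LHS]/(pairingK _ 0) linear0 ev_nil.
rewrite /pairing (bigD1 (Ordinal ak)) //= big1 => [|i]; last first.
  rewrite -val_eqE ffunE => /negbTE /= ->.
  by rewrite -[LHS]/(0 *: (_ : env_module A)) scale0r.
rewrite !ffunE eqxx addr0 ev_bind.
have [f fE] : exists f : {linear A -> A}, forall x, f x = env_act (env_vec bas a.2) x.
  by apply: linear_of => c x y; rewrite env_act_is_linear.
by rewrite -fE ev_additive; apply: eq_ev => x; rewrite /= fE env_vec_act.
Qed.

End Resolution.

(** * The bimodule complex defined by the tables, its exactness and its cohomology *)

Section Complex.
Variables (K : fieldType) (A : falgType K) (p : nat) (rd : resolution_data) (m : nat).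
Variable bas : nat -> A.
Hypothesis pK : p \in [pchar K].
Local Notation N := (rd_dim rd).
Local Notation R := (enveloping A).
Hypothesis bas_free : free_on (fun x => x < N)%N bas.
Hypothesis basM : forall x y, bas x * bas y = ev bas (rmult rd x y).
Hypothesis check : resolution_check rd p m.

Local Notation rvec k := (ffun_vec (env_vec bas) k).
Local Notation avec k := (ffun_vec bas k).

Definition idemw n i := ev (rvec (rank rd n)) (idem rd n i).
Definition diffw n i := ev (rvec (rank rd n)) (gen_diff rd n i).
Definition augw : {ffun 'I_(rank rd 0) -> A} := [ffun i : 'I_ _ => ev bas (gen_aug rd i)].

Definition idemM n := rmulK (rank rd n) (idemw n).
Definition diffM n := rmulK (rank rd n.+1) (diffw n).
Definition augM := pairingK augw.

Let rvec_free k : free_on (dom rd k) (rvec k).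
Proof. exact/free_ffun/free_enveloping. Qed.

Lemma idemM_vec n a : idemM n (rvec _ a) = ev (rvec _) (idem_table rd n a).
Proof. exact: (rmul_vec bas_free basM). Qed.

Lemma diffM_vec n a : diffM n (rvec _ a) = ev (rvec _) (diff_table rd n a).
Proof. exact: (rmul_vec bas_free basM). Qed.

Lemma augM_vec a : augM (rvec _ a) = ev bas (aug_table rd a).
Proof. exact: (pairing_vec bas_free basM). Qed.

Lemma zero_vec (V W : lmodType K) I J (vec : I -> V) (vec' : J -> W) (i : I) :
  (\0 : {linear V -> W}) (vec i) = ev vec' [::].
Proof. by rewrite ev_nil. Qed.

Lemma eq_on_rvec k (V : lmodType K) (J : eqType) (vec' : J -> V)
    (f g : {linear {ffun 'I_k -> R} -> V}) T T' :
  (forall a, f (rvec k a) = ev vec' (T a)) -> (forall a, g (rvec k a) = ev vec' (T' a)) ->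
  same_tables p (bikeys rd k) T T' -> f =1 g.
Proof. by move=> fE gE; apply: (free_eqP pK (rvec_free k) fE gE); apply: mem_bikeys. Qed.

Lemma idemM_idem n x : idemM n (idemM n x) = idemM n x.
Proof.
have [lt_n|le_n] := ltnP n (size (rd_gens rd)); last first.
  have r0 : rank rd n = 0%N by rewrite /rank nth_default.
  by apply/ffunP => -[i lt_i]; exfalso; move: lt_i; rewrite r0.
have /and5P[/allP ch _ _ _ _] := check.
apply: (eq_on_rvec (f := idemM n \o idemM n) (table_comp (@idemM_vec n) (@idemM_vec n))
  (@idemM_vec n)).
by apply: ch; rewrite mem_iota.
Qed.

Lemma diffM_idemM n x : (n <= m)%N -> diffM n (idemM n.+1 x) = diffM n x.
Proof.
move=> le_n; have /and5P[_ /allP ch _ _ _] := check.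
have /ch/and3P[h _ _] : n \in iota 0 m.+1 by rewrite mem_iota.
exact: (eq_on_rvec (f := diffM n \o idemM n.+1)
  (table_comp (@idemM_vec n.+1) (@diffM_vec n)) (@diffM_vec n) h).
Qed.

Lemma idemM_diffM n x : (n <= m)%N -> idemM n (diffM n x) = diffM n x.
Proof.
move=> le_n; have /and5P[_ /allP ch _ _ _] := check.
have /ch/and3P[_ h _] : n \in iota 0 m.+1 by rewrite mem_iota.
exact: (eq_on_rvec (f := idemM n \o diffM n)
  (table_comp (@diffM_vec n) (@idemM_vec n)) (@diffM_vec n) h).
Qed.

Lemma diffM_diffM n x : (n < m)%N -> diffM n (diffM n.+1 x) = 0.
Proof.
move=> lt_n; have /and5P[_ _ /allP ch _ _] := check.
have h : n \in iota 0 m by rewrite mem_iota.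
exact: (eq_on_rvec (f := diffM n \o diffM n.+1) (g := \0)
  (table_comp (@diffM_vec n.+1) (@diffM_vec n)) (zero_vec _ _) (ch _ h)).
Qed.

Lemma augM_diffM x : augM (diffM 0 x) = 0.
Proof.
have /and5P[_ _ _ h _] := check.
exact: (eq_on_rvec (f := augM \o diffM 0) (g := \0)
  (table_comp (@diffM_vec 0) augM_vec) (zero_vec _ _) h).
Qed.

Lemma augM_idemM x : augM (idemM 0 x) = augM x.
Proof.
have /and5P[_ _ _ _ /andP[h _]] := check.
exact: (eq_on_rvec (f := augM \o idemM 0)
  (table_comp (@idemM_vec 0) augM_vec) augM_vec h).
Qed.

Lemma augM_section : exists s : {linear A -> {ffun 'I_(rank rd 0) -> R}},
  (forall x, s (bas x) = ev (rvec _) (unit_table rd x)) /\ cancel s augM.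
Proof.
have [s sE] := free_table (rvec (rank rd 0)) (lookup (rd_unit rd)) bas_free.
exists s; split=> // a; have /and5P[_ _ _ _ /andP[_ h]] := check.
have idE x : (idfun : {linear A -> A}) (bas x) = ev bas [:: (1%N, x)] by rewrite ev1.
apply: (free_eqP (f := augM \o s) (g := idfun) pK bas_free (table_comp sE augM_vec) idE _ h).
by move=> x; rewrite mem_iota.
Qed.

Lemma htp_map n :
  exists s : {linear {ffun 'I_(rank rd n) -> R} -> {ffun 'I_(rank rd n.+1) -> R}},
  forall a, s (rvec _ a) = ev (rvec _) (htp_table rd n a).
Proof. exact: free_table. Qed.

Lemma exact_vec0 x : idemM 0 x = x -> augM x = 0 -> exists y, x = diffM 0 y.
Proof.
move=> xE ax; have [s [sE _]] := augM_section; have [t tE] := htp_map 0.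
have /and5P[_ /allP ch _ _ _] := check.
have /ch/and3P[_ _ h] : 0%N \in iota 0 m.+1 by rewrite mem_iota.
have e : (diffM 0 \o t) \+ (s \o augM) =1 idemM 0.
  apply: (eq_on_rvec _ (@idemM_vec 0) h) => a; rewrite ev_cat.
  congr (_ + _); first exact: (table_comp tE (@diffM_vec 0)).
  exact: (table_comp augM_vec sE).
exists (t x); have := e x; rewrite xE -[LHS]/(diffM 0 (t x) + s (augM x)).
by rewrite ax linear0 addr0.
Qed.

Lemma exact_vecS n x : (n < m)%N -> idemM n.+1 x = x -> diffM n x = 0 ->
  exists y, x = diffM n.+1 y.
Proof.
move=> lt_n xE dx; have [s sE] := htp_map n; have [t tE] := htp_map n.+1.
have /and5P[_ /allP ch _ _ _] := check.
have /ch/and3P[_ _ h] : n.+1 \in iota 0 m.+1 by rewrite mem_iota.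
have e : (diffM n.+1 \o t) \+ (s \o diffM n) =1 idemM n.+1.
  apply: (eq_on_rvec _ (@idemM_vec n.+1) h) => a; rewrite ev_cat.
  congr (_ + _); first exact: (table_comp tE (@diffM_vec n.+1)).
  exact: (table_comp (@diffM_vec n) sE).
exists (t x); have := e x; rewrite xE -[LHS]/(diffM n.+1 (t x) + s (diffM n x)).
by rewrite dx linear0 addr0.
Qed.

Lemma rmulR_idem n (x : {ffun 'I_(rank rd n) -> R^o}) :
  rmulR (rank rd n) (idemw n) (rmulR (rank rd n) (idemw n) x) =
  rmulR (rank rd n) (idemw n) x.
Proof. exact: idemM_idem. Qed.

Definition res_term n : lmodType R := summand (rmulR (rank rd n) (idemw n)).
Definition res_proj n : {linear {ffun 'I_(rank rd n) -> R^o} -> res_term n} :=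
  to_summand (@rmulR_idem n).

(** The differential has to land in a summand in every degree, while [check] guarantees this up to
    [m] only; hence the final projection, which changes nothing in that range by [val_res_diff]. *)
Definition bimod_resolution : augmented_seq (env_module A) :=
  @AugmentedSeq R (env_module A) res_term
    (fun n => res_proj n \o (rmulR (rank rd n.+1) (diffw n) \o val))
    (pairingR augw \o val).

Lemma val_res_diff n (x : res_term n.+1) : (n <= m)%N ->
  val (aug_diff bimod_resolution n x) = diffM n (val x).
Proof. exact: idemM_diffM. Qed.

Lemma res_termE n (x : res_term n) : idemM n (val x) = val x.
Proof. exact: (@summandE _ _ (rmulR _ (idemw n)) x). Qed.

Lemma bimod_resolutionP : partial_resolution bimod_resolution m.
Proof.
split.
- by move=> n _; apply: (summand_projective (@rmulR_idem n)); apply: ffun_projective.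
- split=> [x|n x lt_n].
    by rewrite -[LHS]/(augM (val _)) val_res_diff // augM_diffM.
  by apply: val_inj; rewrite !val_res_diff ?(ltnW lt_n) // diffM_diffM.
- have [s [_ sK]] := augM_section; split=> [y|x ax|n x lt_n dx].
  + exists (res_proj 0 (s y)).
    by rewrite -[LHS]/(augM (idemM 0 (s y))) augM_idemM sK.
  (* The homotopy yields a preimage in the free module; projecting it to the summand keeps its
     image, since the differential absorbs the idempotent. *)
  + have [y yE] := exact_vec0 (res_termE x) ax; exists (res_proj 1 y).
    by apply: val_inj; rewrite val_res_diff // [val (res_proj _ _)]/(idemM 1 y) diffM_idemM.
  + have [|y yE] := exact_vecS lt_n (res_termE x).
      by rewrite -val_res_diff ?(ltnW lt_n) // dx.
    exists (res_proj n.+2 y); apply: val_inj; rewrite val_res_diff //.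
    by rewrite [val (res_proj _ _)]/(idemM n.+2 y) diffM_idemM.
Qed.

Definition coidemM n : {linear {ffun 'I_(rank rd n) -> A} -> {ffun 'I_(rank rd n) -> A}} :=
  amul (rank rd n) (idemw n).
Definition codiffM n : {linear {ffun 'I_(rank rd n) -> A} -> {ffun 'I_(rank rd n.+1) -> A}} :=
  amul (rank rd n.+1) (diffw n).
Definition coprevM n : {linear {ffun 'I_(rank rd n.-1) -> A} -> {ffun 'I_(rank rd n) -> A}} :=
  if n is n'.+1 then codiffM n' else \0.

Lemma coidemM_vec n a : coidemM n (avec _ a) = ev (avec _) (coidem_table rd n a).
Proof. exact: (amul_vec bas_free basM). Qed.

Lemma codiffM_vec n a : codiffM n (avec _ a) = ev (avec _) (codiff_table rd n a).
Proof. exact: (amul_vec bas_free basM). Qed.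

Lemma coprevM_vec n a : coprevM n (avec _ a) = ev (avec _) (coprev_table rd n a).
Proof. by case: n a => [|n] a; [rewrite ev_nil | apply: codiffM_vec]. Qed.

(** The vectors obtained in this way are exactly those fixed by [coidemM], so cohomology can be
    computed in A^k on the image of that idempotent. *)
Definition cochain n (f : {linear res_term n -> env_module A}) : {ffun 'I_(rank rd n) -> A} :=
  [ffun i => f (res_proj n (unit_vec A i))].

Definition of_cochain n (v : {ffun 'I_(rank rd n) -> A}) :
    {linear res_term n -> env_module A} :=
  pairingR v \o val.

Lemma cochainK n (f : {linear res_term n -> env_module A}) : of_cochain (cochain f) =1 f.
Proof.
move=> x; rewrite -{2}[x](to_summand_val (@rmulR_idem n)).
rewrite -[RHS]/((f \o res_proj n) (val x)) linear_unit_vec.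
by apply: eq_bigr => i _; rewrite ffunE.
Qed.

Lemma of_cochainK n v : cochain (of_cochain v) = coidemM n v.
Proof.
apply/ffunP => i; rewrite !ffunE.
by rewrite -[LHS]/(pairing v (rmul (idemw n) (unit_vec A i))) rmul_unit_vec.
Qed.

Lemma coidemM_cochain n (f : {linear res_term n -> env_module A}) :
  coidemM n (cochain f) = cochain f.
Proof.
by rewrite -of_cochainK; apply/ffunP => i; rewrite ![LHS]ffunE cochainK [RHS]ffunE.
Qed.

Lemma of_codiffM n v (x : res_term n.+1) : (n <= m)%N ->
  of_cochain (codiffM n v) x = of_cochain v (aug_diff bimod_resolution n x).
Proof.
move=> le_n; rewrite -[LHS]/(pairing (codiffM n v) (val x)) pairing_amul.
by rewrite -[RHS]/(pairing v (val _)) val_res_diff.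
Qed.

Lemma codiffM_cochain n (f : {linear res_term n -> env_module A}) : (n <= m)%N ->
  codiffM n (cochain f) = cochain (f \o aug_diff bimod_resolution n).
Proof.
move=> le_n; apply/ffunP => i; rewrite [RHS]ffunE.
rewrite -[RHS]/(f (aug_diff bimod_resolution n (res_proj n.+1 (unit_vec A i)))).
rewrite -[RHS]cochainK -[RHS]/(pairing (cochain f) (val _)) val_res_diff //.
rewrite [val (res_proj _ _)]/(idemM n.+1 (unit_vec A i)) diffM_idemM //.
by rewrite -[RHS]/(pairing (cochain f) (rmul (diffw n) (unit_vec A i))) rmul_unit_vec ffunE.
Qed.

Lemma cobound_cochain n (f : {linear res_term n -> env_module A}) : (n <= m)%N ->
  aug_coboundary (C := bimod_resolution) f <-> exists t, cochain f = coprevM n t.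
Proof.
case: n f => [|n] f le_n /=.
  split=> [f0|[t ft] x]; first by exists 0; apply/ffunP => i; rewrite !ffunE f0.
  rewrite -cochainK ft -[LHS]/(pairing 0 (val x)) /pairing big1 // => i _.
  by rewrite ffunE; apply: scaler0.
split=> [[g gE]|[t ft]].
  exists (cochain g); rewrite codiffM_cochain ?(ltnW le_n) //.
  by apply/ffunP => i; rewrite !ffunE gE.
exists (of_cochain t) => x; rewrite -of_codiffM ?(ltnW le_n) //.
by rewrite (_ : codiffM n t = cochain f) ?cochainK // ft.
Qed.

(** On a cocycle the third term of the splitting vanishes, so the cocycle is its combination of
    classes plus a coboundary. The coordinates are unique because the coordinate map kills
    coboundaries and is a left inverse of the map to classes. *)
Theorem bimod_cohomology n cd : (n <= m)%N -> cohomology_check rd p n cd ->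
  aug_cohomology_dim (env_module A) bimod_resolution n (size (cd_cls cd)).
Proof.
move=> le_n /and5P[h1 h2 h3 h4 h5]; set d := size _ in h3 h4 h5 *.
have kfree k : free_on (ffun_dom (fun x => x < N)%N k) (avec k) by apply: free_ffun.
have kmem := @mem_keys rd; have dmem i : (i < d)%N -> i \in iota 0 d by rewrite mem_iota.
have [zm zE] := free_table (avec (rank rd n)) (nth [::] (cd_cls cd)) (free_row K d).
have [C CE] := free_table (row_vec K d) (lookup (cd_coord cd)) (kfree (rank rd n)).
have [T TE] := free_table (avec (rank rd n.-1)) (lookup (cd_prev cd)) (kfree (rank rd n)).
have [S SE] := free_table (avec (rank rd n)) (lookup (cd_next cd)) (kfree (rank rd n.+1)).
have split_id : coidemM n =1 (zm \o C) \+ ((coprevM n \o T) \+ (S \o codiffM n)).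
  apply: (free_eqP pK (kfree _) (@coidemM_vec n) _ (@kmem _) h1) => a.
  rewrite !ev_cat; congr (_ + (_ + _)); first exact: (table_comp CE zE).
    exact: (table_comp TE (@coprevM_vec n)).
  exact: (table_comp (@codiffM_vec n) SE).
have C_prev : C \o coprevM n =1 \0.
  exact: (free_eqP pK (kfree _) (table_comp (@coprevM_vec n) CE)
    (zero_vec _ _) (@kmem _) h2).
have C_z : C \o zm =1 idfun.
  apply: (free_eqP pK (free_row K d) (table_comp zE CE) _ dmem h3) => i.
  by rewrite ev1.
have idem_z : coidemM n \o zm =1 zm.
  exact: (free_eqP pK (free_row K d) (table_comp zE (@coidemM_vec n)) zE dmem h4).
have diff_z : codiffM n \o zm =1 \0.
  exact: (free_eqP pK (free_row K d) (table_comp zE (@codiffM_vec n))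
    (zero_vec _ _) dmem h5).
have zsum c x : of_cochain (zm c) x =
    \sum_i (c 0 i)%:A *: of_cochain (zm (delta_mx 0 i)) x.
  have [L LE] := linear_of (pairing_linearl (val x : {ffun 'I_(rank rd n) -> R})).
  rewrite -[LHS]LE {1}[c]row_sum_delta !linear_sum; apply: eq_bigr => i _.
  by rewrite !linearZ LE env_scaleA.
have sub_z (f : {linear res_term n -> env_module A}) (c : 'rV[K]_d) :
    aug_coboundary (C := bimod_resolution)
      (fun x => f x - \sum_i (c 0 i)%:A *: of_cochain (zm (delta_mx 0 i)) x) <->
    exists t, cochain f - zm c = coprevM n t.
  have -> : cochain f - zm c = cochain (f \- of_cochain (zm c)).
    by rewrite -[in LHS]idem_z -[(_ \o _) c]of_cochainK; apply/ffunP => i; rewrite !ffunE.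
  rewrite -cobound_cochain //.
  by split; apply: aug_coboundary_eq => x; rewrite -zsum.
exists (fun i => of_cochain (zm (delta_mx 0 i))); split=> [i x|f fP].
  rewrite -of_codiffM // -[codiffM n _]/((codiffM n \o zm) _) diff_z.
  rewrite -[LHS]/(pairing 0 (val x)) /pairing big1 // => j _.
  by rewrite ffunE; apply: scaler0.
have diff_f : codiffM n (cochain f) = 0.
  by rewrite codiffM_cochain //; apply/ffunP => i; rewrite !ffunE; apply: fP.
exists (C (cochain f)); split.
  apply/sub_z; exists (T (cochain f)).
  rewrite -[X in X - _]coidemM_cochain split_id /= diff_f linear0 addr0.
  by rewrite addrAC subrr add0r.
move=> c /sub_z[t /(congr1 C)]; rewrite linearB.
rewrite -[C (zm c)]/((C \o zm) c) C_z -[RHS]/((C \o coprevM n) t) C_prev.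
by move/eqP; rewrite subr_eq0 => /eqP.
Qed.

Lemma bimod_HH_dim n cd : (n <= m)%N -> cohomology_check rd p n cd ->
  HH_dim A n (size (cd_cls cd)).
Proof.
move=> le_n /(bimod_cohomology le_n).
exact: (Ext_dim_partial_resolution bimod_resolutionP le_n).
Qed.

End Complex.

(** * Bases of bound quiver algebras *)

Section Rewriting.
Variables (T : eqType) (rules : seq (seq T * option (seq T))).
Implicit Types s t : seq T.

Definition head_step s : option (option (seq T)) :=
  omap (fun r => omap (cat^~ (drop (size r.1) s)) r.2)
    (ohead [seq r <- rules | prefix r.1 s]).

Fixpoint rewrite_step s : option (option (seq T)) :=
  if head_step s is Some u then Some u
  else if s is a :: s' then omap (omap (cons a)) (rewrite_step s') else None.

(** [None] stands for the zero word. Any fuel preserves values by [reduceP]; that the fuel chosen in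
    [word_prod] reaches a listed word is tested by [words_check]. *)
Fixpoint reduce fuel s : option (seq T) :=
  if fuel is n.+1 then
    if rewrite_step s is Some u then obind (reduce n) u else Some s
  else Some s.

Variables (R : pzSemiRingType) (g : T -> R).

Definition word_val s : R := \prod_(a <- s) g a.
Definition oword_val (u : option (seq T)) : R := oapp word_val 0 u.

Hypothesis rulesP : forall r, r \in rules -> word_val r.1 = oword_val r.2.

Lemma word_val_nil : word_val [::] = 1.
Proof. exact: big_nil. Qed.

Lemma word_val_cons a s : word_val (a :: s) = g a * word_val s.
Proof. exact: big_cons. Qed.

Lemma word_val_cat s t : word_val (s ++ t) = word_val s * word_val t.
Proof. exact: big_cat. Qed.

Lemma head_stepP s u : head_step s = Some u -> oword_val u = word_val s.
Proof.
rewrite /head_step; case E: [seq r <- rules | _] => [|r rs] //= [<-].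
have : r \in [seq r <- rules | prefix r.1 s] by rewrite E mem_head.
rewrite mem_filter => /andP[/prefixP[t ->] /rulesP].
rewrite drop_size_cat // word_val_cat => ->.
by case: r.2 => [v|] /=; rewrite ?mul0r // word_val_cat.
Qed.

Lemma rewrite_stepP s u : rewrite_step s = Some u -> oword_val u = word_val s.
Proof.
elim: s u => [|a s IH] u /=; case E: (head_step _) => [v|] //.
- by case=> <-; apply: head_stepP E.
- by case=> <-; apply: head_stepP E.
case F: (rewrite_step s) => [w|] //= [<-].
rewrite word_val_cons -(IH _ F).
by case: w {F} => [w|] /=; rewrite ?mulr0 // word_val_cons.
Qed.

Lemma reduceP n s : oword_val (reduce n s) = word_val s.
Proof.
elim: n s => [|n IH] s //=; case E: (rewrite_step s) => [u|] //=.
by rewrite -(rewrite_stepP E); case: u {E} => //= t.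
Qed.

End Rewriting.

(** * Representations of a quiver as modules over its path algebra *)

Section PathAction.
Variables (K : fieldType) (Q : quiver) (V : lmodType K).
Variables (opV : vertex Q -> {linear V -> V}) (opA : arrow Q -> {linear V -> V}).
Hypothesis opVV : forall v w x, opV v (opV w x) = if v == w then opV w x else 0.
Hypothesis opVA : forall v a x, opV v (opA a x) = if v == src a then opA a x else 0.
Hypothesis opAV : forall a x, opA a (opV (tgt a) x) = opA a x.

Definition word_act (s : seq (arrow Q)) (x : V) : V := foldr (fun a => opA a) x s.

(** Paths compose from left to right and act on the left, so the last arrow acts first, on the part
    of [x] at the end of the path. *)
Definition path_op (x : V) (p : qpath Q) : V := word_act (val p).2 (opV (path_tgt p) x).

Definition path_act (x : V) : path_algebra K Q -> V := path_lift (path_op x).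
HB.instance Definition _ x := GRing.Linear.on (path_act x).

Lemma path_act_elt x p : path_act x (path_elt K p) = path_op x p.
Proof. exact: path_lift_elt. Qed.

Lemma word_act0 s : word_act s 0 = 0.
Proof. by elim: s => //= a s ->; rewrite linear0. Qed.

Lemma word_act_cat s t x : word_act (s ++ t) x = word_act s (word_act t x).
Proof. exact: foldr_cat. Qed.

Lemma opV_path_op v p x :
  opV v (path_op x p) = if v == path_src p then path_op x p else 0.
Proof.
rewrite /path_op /path_src; case: p => -[u [|a s]] w /=; first by rewrite opVV.
by have /andP[/eqP uE _] := w; rewrite opVA uE.
Qed.

Lemma path_op_comp x p q :
  path_op (path_op x q) p = path_act x (path_elt_opt K (pcat p q)).
Proof.
rewrite [LHS]/path_op opV_path_op; case: ifPn => [/eqP|] e.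
  have [r -> rE] := pcatE e; rewrite path_act_elt.
  have rt : path_tgt r = path_tgt q.
    by rewrite /path_tgt rE walk_end_cat -/(path_tgt p) e.
  by rewrite {2}/path_op rt rE /= word_act_cat.
by rewrite /pcat (negbTE e) /= linear0 word_act0.
Qed.

Lemma word_act_linear s : linear (word_act s).
Proof. by move=> c x y; elim: s => //= a s ->; rewrite linearP. Qed.

Lemma path_op_linear p : linear (path_op^~ p).
Proof.
by move=> c x y; rewrite /path_op linearP word_act_linear.
Qed.

Lemma path_act_linearl f : linear (path_act^~ f).
Proof.
move=> c x y; rewrite /path_act /path_lift scaler_sumr -big_split.
by apply: eq_bigr => p _ /=; rewrite path_op_linear scalerDr !scalerA mulrC.
Qed.

Lemma path_actM x f g : path_act x (f * g) = path_act (path_act x g) f.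
Proof.
have [F FE] := linear_of (path_act_linearl f).
rewrite -FE; apply: (path_ext (F := path_act x \o path_mul f) (G := F \o path_act x)) => q.
rewrite /= FE path_act_elt.
apply: (path_ext (F := path_act x \o path_mull (path_elt K q))
  (G := path_act (path_op x q))) => p /=.
by rewrite /path_mull path_mul_elt path_act_elt path_op_comp.
Qed.

Lemma path_act_arrow x a : path_act x (arrow_elt K a) = opA a x.
Proof. by rewrite path_act_elt /path_op /= opAV. Qed.

(** The empty word is excluded: it is the unit, which acts as the sum of the [opV], and this sum is
    not assumed to be the identity. *)
Lemma path_act_word x s : s != [::] ->
  path_act x (word_val (@arrow_elt K Q) s) = word_act s x.
Proof.
elim: s => [|a [|b s] IH] //= _.
  by rewrite word_val_cons word_val_nil mulr1 path_act_arrow.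
by rewrite word_val_cons path_actM path_act_arrow IH.
Qed.

Lemma path_act_ideal rels f :
  (forall r, r \in rels -> forall x, path_act x r = 0) -> in_ideal rels f ->
  forall x, path_act x f = 0.
Proof.
move=> relsP [n [a [r [b [rP ->]]]]] x; rewrite linear_sum big1 // => i _ /=.
rewrite !path_actM (relsP _ (rP i)); have [F FE] := linear_of (path_act_linearl (a i)).
by rewrite -FE linear0.
Qed.

End PathAction.

Lemma free_of_basis (K : fieldType) (A : falgType K) n (bas : nat -> A) :
  (forall i, (n <= i)%N -> bas i = 0) ->
  (forall c : 'I_n -> K, \sum_(i < n) c i *: bas i = 0 -> forall i, c i = 0) ->
  (forall y, exists c : 'I_n -> K, y = \sum_(i < n) c i *: bas i) ->
  free_on (fun i => i < n)%N bas.
Proof.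
move=> out indep span; pose X := [tuple bas i | i < n].
have XE (i : 'I_n) : X`_i = bas i by rewrite -tnth_nth tnth_mktuple.
have freeX : free X.
  apply/freeP => c; under eq_bigr => i _ do rewrite XE.
  exact: indep.
have spanX y : y = \sum_(i < n) coord X i y *: bas i.
  have yX : y \in <<X>>%VS.
    have [c ->] := span y; apply: memv_suml => i _; apply: memvZ.
    by rewrite -XE; apply/memv_span/mem_nth; rewrite size_tuple.
  by rewrite {1}(coord_span yX); under eq_bigr => i _ do rewrite XE.
split=> [i|W T|W f g fg a]; first by rewrite -leqNgt; apply: out.
  have [f fE] : exists f : {linear A -> W}, forall a, f a = \sum_i coord X i a *: T i.
    apply: linear_of => c x y; rewrite scaler_sumr -big_split; apply: eq_bigr => i _ /=.
    by rewrite linearP scalerDl scalerA.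
  exists f => i lt_i; rewrite fE (_ : bas i = X`_(Ordinal lt_i)); last by rewrite XE.
  rewrite (bigD1 (Ordinal lt_i)) // coord_free // eqxx scale1r big1 => [|j nj].
    exact: addr0.
  by rewrite coord_free // eq_sym (negbTE nj) scale0r.
rewrite [a]spanX !linear_sum; apply: eq_bigr => i _.
by rewrite !linearZ /= fg.
Qed.

Lemma path_eltM (K : fieldType) (Q : quiver) (x y : qpath Q) :
  path_elt K x * path_elt K y = path_elt_opt K (pcat x y).
Proof. exact: path_mul_elt. Qed.

Lemma arrow_eltK (K : fieldType) (Q : quiver) (a : arrow Q) :
  arrow_elt K a * path_elt K (triv_path (tgt a)) = arrow_elt K a.
Proof.
by rewrite /arrow_elt path_eltM pcat_trivr /path_tgt /= /walk_end /= eqxx.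
Qed.

(** * Normal words: structure constants, spanning and independence *)

Section NormalWords.
Variables (Q : quiver) (words : seq (vertex Q * seq (arrow Q))).
Variables (rules : seq (seq (arrow Q) * option (seq (arrow Q)))).
Variable rels : seq (seq (arrow Q) * option (seq (arrow Q))).
Variables (vertices : seq (vertex Q)) (arrows : seq (arrow Q)).
Local Notation word := (vertex Q * seq (arrow Q))%type.

Definition word_prod (u w : word) : option word :=
  if walk_end u.1 u.2 == w.1 then
    omap (pair u.1) (reduce rules (size u.2 + size w.2) (u.2 ++ w.2))
  else None.

Definition word_index (w : option word) : comb nat :=
  if w is Some u then [:: (1%N, index u words)] else [::].

Definition word_table : seq (seq (comb nat)) :=
  [seq [seq word_index (word_prod u w) | w <- words] | u <- words].

(** A parameter, pinned to [word_table] by [words_check], so that products are read off an evaluated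
    list instead of being rewritten anew. *)
Variable tab : seq (seq (comb nat)).
Local Notation N := (size words).
Local Notation mul := (tmult tab).

Definition vertex_index v := index (v, [::] : seq (arrow Q)) words.
Definition arrow_index a := index (src a, [:: a]) words.

Definition act_word (s : seq (arrow Q)) (t : comb nat) : comb nat :=
  foldr (fun a u => bind u (mul (arrow_index a))) t s.

(* From the sixth one on, the conditions say that the multiplication table defines
   a representation of the quiver which satisfies the relations and where each word
   sends the unit to the corresponding basis vector. *)
Definition words_check p : bool :=
  [&& tab == word_table,
      uniq words && all (fun w => walk w.1 w.2) words,
      all (fun v => (v, [::]) \in words) vertices,
      all (fun a => (src a, [:: a]) \in words) arrows,
      all (fun u => all (fun w =>
        if word_prod u w is Some x then x \in words else true) words) words,
      all (fun v => all (fun w => same_tables p (iota 0 N)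
        (fun j => bind (mul (vertex_index w) j) (mul (vertex_index v)))
        (fun j => if v == w then mul (vertex_index w) j else [::])) vertices) vertices,
      all (fun v => all (fun a => same_tables p (iota 0 N)
        (fun j => bind (mul (arrow_index a) j) (mul (vertex_index v)))
        (fun j => if v == src a then mul (arrow_index a) j else [::])) arrows) vertices,
      all (fun a => same_tables p (iota 0 N)
        (fun j => bind (mul (vertex_index (tgt a)) j) (mul (arrow_index a)))
        (mul (arrow_index a))) arrows,
      all (fun w => comb_eq p
        (act_word w.2 (bind [seq (1%N, vertex_index v) | v <- vertices]
                            (mul (vertex_index (walk_end w.1 w.2)))))
        [:: (1%N, index w words)]) words &
      all (fun r => [&& r.1 != [::], r.2 != Some [::] & same_tables p (iota 0 N)
        (fun j => act_word r.1 [:: (1%N, j)])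
        (fun j => if r.2 is Some s then act_word s [:: (1%N, j)] else [::])]) rels].

Variable w0 : word.
Variables (K : fieldType) (p : nat) (A : falgType K).
Hypothesis pK : p \in [pchar K].
Hypothesis check : words_check p.
Hypothesis verticesP : forall v, v \in vertices.
Hypothesis arrowsP : forall a, a \in arrows.
Variable phi : {lrmorphism path_algebra K Q -> A}.
Hypothesis rulesP : forall r, r \in rules ->
  word_val (fun a => phi (arrow_elt K a)) r.1 =
  oword_val (fun a => phi (arrow_elt K a)) r.2.

Local Notation pr := (word_val (fun a => phi (arrow_elt K a))).

Definition word_elt (w : word) : path_algebra K Q :=
  path_elt K (triv_path w.1) * word_val (@arrow_elt K Q) w.2.

Lemma word_elt_path (p0 : qpath Q) : word_elt (val p0) = path_elt K p0.
Proof.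
suff E s v (w : walk v s) : word_elt (v, s) = path_elt K (@QPath Q (v, s) w).
  by case: p0 => -[v s] w; apply: E.
elim: s v w => [|a s IH] v w.
  rewrite /word_elt /word_val big_nil mulr1; congr path_elt; exact: val_inj.
have /andP[/eqP sa ws] := w.
have -> : word_elt (v, a :: s) =
    path_elt K (triv_path v) * (arrow_elt K a * word_elt (tgt a, s)).
  by rewrite /word_elt word_val_cons [X in _ = _ * X]mulrA [X in _ = _ * (X * _)]arrow_eltK.
rewrite (IH _ ws) -[RHS]/(path_elt_opt K (Some _)).
have [r rE vr] := @pcatE Q (arrow_path a) (@QPath Q (tgt a, s) ws) erefl.
rewrite /arrow_elt.
rewrite [X in _ * X](path_eltM K (arrow_path a)) rE path_eltM pcat_trivl (pcat_src rE).
rewrite -[path_src (arrow_path a)]/(src a) sa eqxx.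
by congr path_elt; apply: val_inj; rewrite vr -[path_src (arrow_path a)]/(src a) sa.
Qed.

Definition word_bas (i : nat) : A :=
  if (i < N)%N then phi (word_elt (nth w0 words i)) else 0.

Lemma word_basE w : w \in words -> word_bas (index w words) = phi (word_elt w).
Proof. by move=> ww; rewrite /word_bas index_mem ww nth_index. Qed.

Lemma word_bas_out i : (N <= i)%N -> word_bas i = 0.
Proof. by rewrite leqNgt /word_bas => /negbTE ->. Qed.

Lemma phi_word_elt v s : phi (word_elt (v, s)) = phi (path_elt K (triv_path v)) * pr s.
Proof. by rewrite rmorphM rmorph_prod. Qed.

Lemma words_path w : w \in words -> exists q : qpath Q, w = val q.
Proof.
have /and5P[_ /andP[_ /allP ch] _ _ _] := check.
by case: w => v s /ch w; exists (@QPath Q (v, s) w).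
Qed.

Lemma word_prodP u w : u \in words -> w \in words ->
  phi (word_elt u) * phi (word_elt w) = ev word_bas (word_index (word_prod u w)).
Proof.
move=> uw ww; have /and5P[_ _ _ _ /andP[/allP/(_ u uw)/allP/(_ w ww) ch _]] := check.
move: ch; have [[q uq] [r wr]] := (words_path uw, words_path ww).
rewrite -rmorphM uq wr !word_elt_path path_eltM /word_prod.
case: ifPn => [/eqP e|e] ch; last first.
  by rewrite /pcat [X in if X then _ else _](negbTE e) ev_nil rmorph0.
have [t -> tE] := pcatE e.
rewrite -[LHS]/(phi (path_elt K t)) -word_elt_path tE phi_word_elt.
rewrite -(reduceP rulesP (size (val q).2 + size (val r).2)).
case: reduce ch => [x|] ch /=; last by rewrite mulr0 ev_nil.
by rewrite ev1 word_basE // phi_word_elt.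
Qed.

Lemma word_basM x y : word_bas x * word_bas y = ev word_bas (mul x y).
Proof.
have /andP[/eqP tE _] := check; rewrite /tmult tE.
have [xN|xN] := ltnP x N; last first.
  rewrite word_bas_out // mul0r (nth_default _ (s := word_table)) ?size_map //.
  by rewrite nth_nil ev_nil.
rewrite (nth_map w0) //; have [yN|yN] := ltnP y N; last first.
  by rewrite [word_bas y]word_bas_out // mulr0 nth_default ?size_map // ev_nil.
rewrite (nth_map w0) // -word_prodP ?mem_nth //.
by rewrite /word_bas xN yN.
Qed.

Lemma mul_out x y : (N <= y)%N -> mul x y = [::].
Proof.
have /andP[/eqP tE _] := check; rewrite /tmult tE => yN.
have [xN|xN] := ltnP x N; last first.
  by rewrite (nth_default _ (s := word_table)) ?size_map ?nth_nil.
by rewrite (nth_map w0) // nth_default ?size_map.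
Qed.

Lemma vertex_words v : (v, [::]) \in words.
Proof. by have /and5P[_ _ /allP ch _ _] := check; apply/ch/verticesP. Qed.

Lemma arrow_words a : (src a, [:: a]) \in words.
Proof. by have /and5P[_ _ _ /allP ch _] := check; apply/ch/arrowsP. Qed.

Lemma phi_vertex v : phi (path_elt K (triv_path v)) = word_bas (vertex_index v).
Proof.
rewrite word_basE ?vertex_words //; congr (phi _).
by rewrite /word_elt /word_val big_nil mulr1.
Qed.

Lemma phi_arrow a : phi (arrow_elt K a) = word_bas (arrow_index a).
Proof.
rewrite word_basE ?arrow_words //; congr (phi _); rewrite /word_elt /word_val big_seq1.
by rewrite /arrow_elt path_eltM pcat_trivl /path_src /= eqxx.
Qed.

Hypothesis phi_surj : forall y, exists x, phi x = y.

Definition bas_span y := exists c : 'I_N -> K, y = \sum_(i < N) c i *: word_bas i.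

Lemma bas_span0 : bas_span 0.
Proof. by exists (fun=> 0); rewrite big1 // => i _; rewrite scale0r. Qed.

Lemma bas_spanD u v : bas_span u -> bas_span v -> bas_span (u + v).
Proof.
move=> [c ->] [d ->]; exists (fun i => c i + d i); rewrite -big_split.
by apply: eq_bigr => i _; rewrite scalerDl.
Qed.

Lemma bas_spanZ a u : bas_span u -> bas_span (a *: u).
Proof.
move=> [c ->]; exists (fun i => a * c i); rewrite scaler_sumr.
by apply: eq_bigr => i _; rewrite scalerA.
Qed.

Lemma bas_span_sum (I : Type) (r : seq I) (F : I -> A) :
  (forall i, bas_span (F i)) -> bas_span (\sum_(i <- r) F i).
Proof.
move=> FS; elim: r => [|i r IH]; first by rewrite big_nil; apply: bas_span0.
by rewrite big_cons; apply: bas_spanD.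
Qed.

Lemma bas_span_bas i : bas_span (word_bas i).
Proof.
have [iN|iN] := ltnP i N; last by rewrite word_bas_out //; apply: bas_span0.
exists (fun j => (j == Ordinal iN)%:R); rewrite (bigD1 (Ordinal iN)) //= eqxx scale1r.
by rewrite big1 ?addr0 // => j /negbTE ->; rewrite scale0r.
Qed.

Lemma bas_span_basM i u : bas_span u -> bas_span (word_bas i * u).
Proof.
move=> [c ->]; rewrite mulr_sumr; apply: bas_span_sum => j.
rewrite -scalerAr word_basM; apply: bas_spanZ; apply: bas_span_sum => a.
by rewrite -scaler_nat; apply/bas_spanZ/bas_span_bas.
Qed.

(** The span is stable under left multiplication by arrows, by the multiplication table, and
    contains 1 as the sum of the vertex idempotents. *)
Lemma bas_span_word s : bas_span (pr s).
Proof.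
elim: s => [|a s IH]; last first.
  rewrite word_val_cons [X in X * _]phi_arrow.
  apply: bas_span_basM.
  exact: IH.
have phi1 : 1 = \sum_v phi (path_elt K (triv_path v)).
  by rewrite -(rmorph1 phi); apply: (linear_sum phi).
rewrite word_val_nil phi1; apply: bas_span_sum => v.
by rewrite phi_vertex; apply: bas_span_bas.
Qed.

Lemma word_bas_span y : bas_span y.
Proof.
have [x <-] := phi_surj y; rewrite [x]path_expand linear_sum; apply: bas_span_sum => q.
rewrite linearZ -[path_elt K q]word_elt_path; apply: bas_spanZ.
case: (val q) => v s; rewrite -[X in bas_span X]/(phi _) phi_word_elt [X in X * _]phi_vertex.
exact: bas_span_basM (bas_span_word s).
Qed.

Definition relation (r : seq (arrow Q) * option (seq (arrow Q))) : path_algebra K Q :=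
  word_val (@arrow_elt K Q) r.1 - oword_val (@arrow_elt K Q) r.2.

Hypothesis phi_ker : forall x, phi x = 0 -> in_ideal [seq relation r | r <- rels] x.

Local Notation rV := 'rV[K]_N.
Local Notation rvec := (row_vec K N).

Lemma mul_op k : exists f : {linear rV -> rV}, forall i, f (rvec i) = ev rvec (mul k i).
Proof.
have [f fE] := free_table rvec (mul k) (free_row K N).
exists f => i; rewrite fE /comb_on; case: ltnP => // iN.
by rewrite mul_out.
Qed.

Lemma eq_on_row_vec (f g : {linear rV -> rV}) T T' :
  (forall i, f (rvec i) = ev rvec (T i)) -> (forall i, g (rvec i) = ev rvec (T' i)) ->
  same_tables p (iota 0 N) T T' -> f =1 g.
Proof.
move=> fE gE; apply: (free_eqP pK (free_row K N) fE gE) => i.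
by rewrite mem_iota.
Qed.

Lemma word_bas_free : free_on (fun i => i < N)%N word_bas.
Proof.
apply: free_of_basis word_bas_span; first exact: word_bas_out.
have [opV opVE] := fin_all_exists (fun v => mul_op (vertex_index v)).
have [opA opAE] := fin_all_exists (fun a => mul_op (arrow_index a)).
have /and5P[_ _ _ _ /and5P[_ /allP chVV /allP chVA /allP chAV ch]] := check.
have /andP[/allP chw /allP chr] := ch => {ch}.
have opVV v w x : opV v (opV w x) = if v == w then opV w x else 0.
  have /chVV/allP/(_ w (verticesP w)) ch := verticesP v.
  case: (v == w) ch => ch; first exact: (eq_on_row_vec (f := opV v \o opV w)
    (table_comp (opVE w) (opVE v)) (opVE w) ch).
  by apply: (eq_on_row_vec (f := opV v \o opV w) (g := \0)
    (table_comp (opVE w) (opVE v)) _ ch) => i; rewrite ev_nil.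
have opVA v a x : opV v (opA a x) = if v == src a then opA a x else 0.
  have /chVA/allP/(_ a (arrowsP a)) ch := verticesP v.
  case: (v == src a) ch => ch; first exact: (eq_on_row_vec (f := opV v \o opA a)
    (table_comp (opAE a) (opVE v)) (opAE a) ch).
  by apply: (eq_on_row_vec (f := opV v \o opA a) (g := \0)
    (table_comp (opAE a) (opVE v)) _ ch) => i; rewrite ev_nil.
have opAV a x : opA a (opV (tgt a) x) = opA a x.
  have /chAV ch := arrowsP a.
  exact: (eq_on_row_vec (f := opA a \o opV (tgt a))
    (table_comp (opVE _) (opAE a)) (opAE a) ch).
have actA u t : word_act opA u (ev rvec t) = ev rvec (act_word u t).
  elim: u => //= a u ->; rewrite ev_additive ev_bind; apply: eq_ev => j.
  exact: opAE.
(* The unit of the algebra, written in coordinates. *)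
pose one := ev rvec [seq (1%N, vertex_index v) | v <- vertices].
have actE w : w \in words -> path_act opV opA one (word_elt w) = rvec (index w words).
  move=> ww; have [q wq] := words_path ww; rewrite {1}wq word_elt_path path_act_elt.
  rewrite -[RHS](ev1 rvec) -(comb_eq_ev (p := p) rvec _ (chw _ ww)) => [|v]; last first.
    by rewrite -scaler_nat pcharf0 ?scale0r.
  rewrite -actA ev_bind /path_op -[path_tgt q]/(walk_end (val q).1 (val q).2) -wq.
  by congr word_act; rewrite /one ev_additive; apply: eq_ev => j; apply: opVE.
have rels0 r x : r \in [seq relation r | r <- rels] -> path_act opV opA x r = 0.
  move=> /mapP[u /chr/and3P[u1 u2 ch] ->]; rewrite linearB /= path_act_word //.
  have [f fE] := linear_of (word_act_linear opA u.1).
  have fT i : f (rvec i) = ev rvec (act_word u.1 [:: (1%N, i)]) by rewrite fE -actA ev1.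
  case: u.2 u2 ch => [t|] /= t1 ch; last first.
    rewrite linear0 subr0 -fE; apply: (eq_on_row_vec (g := \0) fT _ ch) => i.
    by rewrite ev_nil.
  have [g gE] := linear_of (word_act_linear opA t).
  rewrite path_act_word // -fE -gE; apply/eqP; rewrite subr_eq0; apply/eqP.
  by apply: (eq_on_row_vec fT _ ch) => i; rewrite gE -actA ev1.
move=> c c0 i.
(* A vanishing combination in A lifts to an element of the ideal, which acts as zero; applied to
   [one], it returns the row of its coefficients. *)
have : in_ideal [seq relation r | r <- rels] (\sum_(j < N) c j *: word_elt (nth w0 words j)).
  apply: phi_ker; rewrite linear_sum -[RHS]c0; apply: eq_bigr => j _.
  by rewrite linearZ /= /word_bas ltn_ord.
move=> /(path_act_ideal opVV opVA (fun r rr x => rels0 r x rr))/(_ one).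
have /and5P[_ /andP[uw _] _ _ _] := check.
have -> : path_act opV opA one (\sum_(j < N) c j *: word_elt (nth w0 words j)) =
    \sum_(j < N) c j *: delta_mx 0 j.
  rewrite linear_sum; apply: eq_bigr => j _.
  by rewrite linearZ /= actE ?mem_nth // index_uniq // row_vecE.
move/rowP/(_ i); rewrite mxE summxE (bigD1 i) //= big1 => [|j nj].
  by rewrite !mxE !eqxx mulr1 addr0.
by rewrite !mxE eq_sym (negbTE nj) andbF mulr0.
Qed.

End NormalWords.

(** The rules may go beyond the defining relations, as long as they follow from them for any images
    of the arrows in A. *)
Lemma bound_quiver_basis (K : fieldType) (p : nat) (Q : quiver) (A : falgType K)
    rels words rules (vertices : seq (vertex Q)) (arrows : seq (arrow Q)) tab :
  p \in [pchar K] -> bound_quiver_algebra [seq relation K r | r <- rels] A ->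
  (forall v, v \in vertices) -> (forall a, a \in arrows) ->
  (forall f : arrow Q -> A,
    (forall r, r \in rels -> word_val f r.1 = oword_val f r.2) ->
    forall r, r \in rules -> word_val f r.1 = oword_val f r.2) ->
  words_check words rules rels vertices arrows tab p ->
  exists2 bas : nat -> A, free_on (fun i => i < size words)%N bas &
    forall x y, bas x * bas y = ev bas (tmult tab x y).
Proof.
move=> pK [phi [surj ker]] vP aP rulesP check.
have rulesphi : forall r, r \in rules ->
    word_val (fun a => phi (arrow_elt K a)) r.1 =
    oword_val (fun a => phi (arrow_elt K a)) r.2.
  apply: rulesP => r rr; apply/eqP; rewrite -subr_eq0.
  have /ker : in_ideal [seq relation K r | r <- rels] (relation K r).
    exists 1%N, (fun=> 1), (fun=> relation K r), (fun=> 1).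
    by split=> [_|]; [apply: map_f | rewrite big_ord1 mul1r mulr1].
  rewrite /relation rmorphB /= rmorph_prod => <-; case: r.2 => [s|] /=.
    by rewrite rmorph_prod.
  by rewrite rmorph0.
have [v0 _] := card_gt0P (vertex_gt0 Q); pose w0 := (v0, [::] : seq (arrow Q)).
exists (word_bas words w0 phi); last exact: (word_basM w0 check rulesphi).
exact: (word_bas_free w0 pK check vP aP rulesphi surj (fun x => proj1 (ker x))).
Qed.

Lemma HH_dim_bound_quiver (K : fieldType) (p : nat) (Q : quiver) (A : falgType K)
    rels words rules (vertices : seq (vertex Q)) (arrows : seq (arrow Q)) rd m :
  p \in [pchar K] -> bound_quiver_algebra [seq relation K r | r <- rels] A ->
  (forall v, v \in vertices) -> (forall a, a \in arrows) ->
  (forall f : arrow Q -> A,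
    (forall r, r \in rels -> word_val f r.1 = oword_val f r.2) ->
    forall r, r \in rules -> word_val f r.1 = oword_val f r.2) ->
  words_check words rules rels vertices arrows (rd_mul rd) p ->
  rd_dim rd = size words -> resolution_check rd p m ->
  forall n cd, (n <= m)%N -> cohomology_check rd p n cd ->
  HH_dim A n (size (cd_cls cd)).
Proof.
move=> pK relsA vP aP rulesP wch dimE rch n cd le_n cch.
have [bas basF basM] := bound_quiver_basis pK relsA vP aP rulesP wch.
rewrite -dimE in basF; exact: (bimod_HH_dim pK basF basM rch le_n cch).
Qed.

(** * The two algebras *)

Local Open Scope nat_scope.

Definition words1 : seq (vertex Q * seq (arrow Q)) :=
  [:: (V1, [::]); (V2, [::]); (V2, [:: Alpha]); (V2, [:: Alpha; Alpha]);
      (V2, [:: Alpha; Alpha; Alpha]); (V2, [:: Alpha; Alpha; Alpha; Alpha]);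
      (V2, [:: Gamma]); (V2, [:: Alpha; Gamma]); (V2, [:: Alpha; Alpha; Gamma]);
      (V1, [:: Beta]); (V1, [:: Beta; Alpha]); (V1, [:: Beta; Alpha; Alpha]);
      (V1, [:: Beta; Gamma]); (V1, [:: Beta; Alpha; Gamma])].

Definition rels1 : seq (seq (arrow Q) * option (seq (arrow Q))) :=
  [:: ([:: Alpha; Alpha], Some [:: Gamma; Beta]);
      ([:: Beta; Alpha; Gamma], Some [:: Beta; Alpha; Alpha; Gamma]);
      ([:: Alpha; Alpha; Alpha; Alpha; Alpha], None)].

(** The relations, oriented and completed by the consequences alpha^3 gamma = 0 and beta alpha^3 =
    0. *)
Definition rules1 : seq (seq (arrow Q) * option (seq (arrow Q))) :=
  [:: ([:: Gamma; Beta], Some [:: Alpha; Alpha]);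
      ([:: Beta; Alpha; Alpha; Gamma], Some [:: Beta; Alpha; Gamma]);
      ([:: Alpha; Alpha; Alpha; Gamma], None); ([:: Beta; Alpha; Alpha; Alpha], None);
      ([:: Alpha; Alpha; Alpha; Alpha; Alpha], None)].

Definition mul1 := Eval vm_compute in word_table words1 rules1.

(** Generators in degrees 0, 1, 2: the vertices; the arrows beta, gamma, alpha (gamma with opposite
    sign); the relations beta alpha gamma = beta alpha^2 gamma and gamma beta = alpha^2. With I the
    ideal of relations and J that of the arrows, degree 2 corresponds to a basis of I / (IJ + JI),
    where alpha^5 is zero because the two relations give alpha^5 = alpha^6. The differential of a
    relation sums prefix (x) suffix over the arrows occurring in it. *)
Definition resolution1 : resolution_data := {|
  rd_dim := 14;
  rd_mul := mul1;
  rd_gens :=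
    [:: [:: (0, 0); (1, 1)];
        [:: (0, 1); (1, 0); (1, 1)];
        [:: (0, 0); (1, 1)];
        [:: (0, 0); (1, 1)]];
  rd_diff :=
    [:: [:: [:: (1, (0, (0, 9))); (2, (1, (9, 1)))];
          [:: (1, (0, (6, 0))); (2, (1, (1, 6)))];
          [:: (1, (1, (1, 2))); (2, (1, (2, 1)))]];
      [:: [:: (1, (0, (0, 7))); (2, (0, (0, 8))); (2, (1, (10, 0))); (1, (1, (11, 0)));
              (1, (2, (9, 6))); (2, (2, (9, 7))); (2, (2, (10, 6)))];
          [:: (1, (0, (6, 1))); (2, (1, (1, 9))); (2, (2, (1, 2))); (2, (2, (2, 1)))]];
      [:: [:: (1, (0, (0, 12))); (2, (0, (12, 0))); (1, (1, (9, 7))); (2, (1, (9, 8)));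
              (2, (1, (10, 6))); (1, (1, (11, 6)))];
          [:: (1, (0, (6, 10))); (2, (0, (7, 9))); (2, (1, (1, 5))); (1, (1, (2, 4)));
              (2, (1, (2, 5))); (2, (1, (4, 2))); (1, (1, (5, 1))); (1, (1, (5, 2)))]]];
  rd_unit :=
    [:: (0, [:: (1, (0, (0, 0)))]); (1, [:: (1, (1, (1, 1)))]); (2, [:: (1, (1, (1, 2)))]);
        (3, [:: (1, (1, (1, 3)))]); (4, [:: (1, (1, (1, 4)))]); (5, [:: (1, (1, (1, 5)))]);
        (6, [:: (1, (1, (1, 6)))]); (7, [:: (1, (1, (1, 7)))]); (8, [:: (1, (1, (1, 8)))]);
        (9, [:: (1, (0, (0, 9)))]); (10, [:: (1, (0, (0, 10)))]);
        (11, [:: (1, (0, (0, 11)))]); (12, [:: (1, (0, (0, 12)))]);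
        (13, [:: (1, (0, (0, 13)))])];
  rd_htp :=
    [:: [:: ((0, 6), [:: (1, (1, (1, 0)))]);
          ((0, 7), [:: (1, (1, (2, 0))); (2, (2, (1, 6)))]);
          ((0, 8), [:: (2, (0, (6, 6))); (1, (1, (1, 12))); (1, (1, (3, 0)))]);
          ((0, 12), [:: (2, (0, (0, 6))); (1, (1, (9, 0)))]);
          ((0, 13), [:: (2, (0, (0, 8))); (2, (0, (12, 6))); (1, (1, (9, 12)));
                      (1, (1, (11, 0)))]);
          ((1, 2), [:: (2, (2, (1, 1)))]);
          ((1, 3), [:: (2, (0, (6, 1))); (1, (1, (1, 9)))]);
          ((1, 4), [:: (2, (0, (7, 1))); (1, (1, (2, 9))); (2, (2, (1, 3)))]);
          ((1, 5), [:: (2, (0, (6, 3))); (2, (0, (8, 1))); (1, (1, (1, 11)));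
                      (1, (1, (3, 9)))]);
          ((1, 9), [:: (2, (0, (0, 1)))]);
          ((1, 10), [:: (2, (0, (0, 2))); (2, (2, (9, 1)))]);
          ((1, 11), [:: (2, (0, (0, 3))); (2, (0, (12, 1))); (1, (1, (9, 9)))])];
      [:: ((0, 13), [:: (1, (0, (0, 10))); (1, (0, (12, 9))); (1, (0, (12, 10)));
                      (1, (0, (12, 11))); (1, (1, (9, 3))); (2, (1, (9, 4)));
                      (2, (1, (10, 2))); (1, (1, (11, 1))); (1, (1, (11, 2)))]);
          ((1, 4), [:: (2, (0, (6, 0))); (2, (0, (6, 13))); (2, (0, (7, 0)));
                      (2, (0, (7, 13))); (2, (0, (8, 0))); (1, (1, (1, 7)));
                      (2, (1, (1, 8))); (2, (1, (2, 6))); (1, (1, (2, 7)));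
                      (2, (1, (2, 8))); (1, (1, (3, 7))); (2, (1, (3, 8)));
                      (1, (1, (4, 7)))]);
          ((1, 5), [:: (2, (0, (6, 13))); (2, (0, (7, 0))); (2, (0, (7, 13)));
                      (2, (0, (8, 0))); (2, (1, (1, 8))); (1, (1, (2, 7)));
                      (2, (1, (2, 8))); (2, (1, (3, 6))); (1, (1, (3, 7)));
                      (2, (1, (3, 8))); (1, (1, (4, 7)))]);
          ((1, 10), [:: (2, (0, (0, 0))); (1, (1, (9, 6)))]);
          ((2, 2), [:: (2, (1, (1, 1)))]);
          ((2, 3), [:: (1, (1, (1, 2))); (2, (1, (2, 1)))]);
          ((2, 4), [:: (2, (1, (1, 3))); (1, (1, (2, 2))); (2, (1, (3, 1)))]);
          ((2, 5), [:: (1, (0, (6, 9))); (1, (0, (6, 10))); (1, (0, (6, 11)));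
                      (1, (0, (7, 11))); (1, (0, (8, 11))); (1, (1, (3, 2)));
                      (2, (1, (4, 1))); (2, (1, (4, 2))); (2, (1, (4, 3)));
                      (1, (1, (5, 1))); (1, (1, (5, 2)))]);
          ((2, 10), [:: (2, (1, (9, 1)))]);
          ((2, 11), [:: (1, (0, (0, 9))); (1, (0, (0, 10))); (1, (0, (12, 9)));
                      (1, (0, (12, 10))); (1, (0, (12, 11))); (1, (1, (9, 2)));
                      (2, (1, (9, 4))); (2, (1, (10, 1))); (2, (1, (10, 2)));
                      (1, (1, (11, 1))); (1, (1, (11, 2)))])];
      [:: ((0, 7), [:: (1, (0, (6, 0))); (1, (0, (6, 12))); (2, (0, (6, 13)));
                      (1, (0, (8, 0)))]);
          ((0, 8), [:: (2, (0, (6, 0))); (1, (0, (6, 13))); (2, (0, (7, 12)))]);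
          ((0, 12), [:: (2, (0, (0, 0))); (1, (0, (0, 12)))]);
          ((0, 13), [:: (2, (0, (0, 12))); (1, (0, (0, 13))); (2, (0, (12, 0)))]);
          ((1, 4), [:: (1, (0, (6, 9))); (2, (0, (6, 11))); (1, (0, (7, 9)));
                      (1, (0, (8, 10))); (1, (1, (1, 1)))]);
          ((1, 5), [:: (1, (0, (6, 9))); (1, (1, (1, 1)))]);
          ((1, 11), [:: (1, (0, (0, 9)))])]]
|}.

(** The centre: beta alpha gamma, alpha^3, alpha^4, 1, beta gamma + alpha^2. *)
Definition cohomology1_0 : cohomology_data := {|
  cd_cls := [:: [:: (1, (0, 13))]; [:: (1, (1, 4))]; [:: (1, (1, 5))];
                [:: (1, (0, 0)); (1, (1, 1))]; [:: (1, (0, 12)); (1, (1, 3))]];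
  cd_coord :=
    [:: ((0, 13), [:: (1, 0)]); ((1, 1), [:: (1, 3)]); ((1, 3), [:: (1, 4)]);
        ((1, 4), [:: (1, 1)]); ((1, 5), [:: (1, 2)])];
  cd_prev := [::];
  cd_next :=
    [:: ((0, 9), [:: (1, (0, 0))]); ((0, 10), [:: (2, (1, 2))]);
        ((0, 11), [:: (1, (0, 12))])]
|}.

(** Three derivations, zero on the arrows not named: alpha -> alpha^4; beta -> beta alpha, alpha ->
    -alpha^2; beta -> beta alpha^2, alpha -> -alpha^3. The last two respect alpha^2 = gamma beta
    because -2 = 1 modulo 3. *)
Definition cohomology1_1 : cohomology_data := {|
  cd_cls := [:: [:: (1, (2, 5))]; [:: (1, (0, 10)); (2, (2, 3))];
                [:: (1, (0, 11)); (2, (2, 4))]];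
  cd_coord :=
    [:: ((2, 3), [:: (2, 1)]); ((2, 4), [:: (2, 2)]); ((2, 5), [:: (1, 0)])];
  cd_prev :=
    [:: ((1, 6), [:: (1, (0, 0))]); ((1, 7), [:: (2, (1, 2))]); ((1, 8), [:: (1, (0, 12))])];
  cd_next :=
    [:: ((0, 12), [:: (2, (0, 9)); (1, (2, 1)); (1, (2, 2))]);
        ((0, 13), [:: (1, (0, 9)); (2, (2, 2))]); ((1, 3), [:: (1, (0, 9))]);
        ((1, 4), [:: (2, (0, 9)); (1, (0, 10)); (1, (2, 2))]); ((1, 5), [:: (1, (0, 11))])]
|}.

(** First-order deformations of the relations: of beta alpha gamma - beta alpha^2 gamma by e_1 or by
    beta gamma, of gamma beta - alpha^2 by e_2. *)
Definition cohomology1_2 : cohomology_data := {|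
  cd_cls := [:: [:: (1, (0, 0))]; [:: (1, (0, 12))]; [:: (1, (1, 1))]];
  cd_coord :=
    [:: ((0, 0), [:: (1, 0)]); ((0, 12), [:: (1, 1)]); ((1, 1), [:: (1, 2)]);
        ((1, 2), [:: (2, 1)])];
  cd_prev :=
    [:: ((0, 13), [:: (1, (0, 9)); (2, (2, 2))]);
        ((1, 2), [:: (2, (0, 9)); (1, (2, 1)); (1, (2, 2))]); ((1, 3), [:: (1, (0, 9))]);
        ((1, 4), [:: (2, (0, 9)); (1, (0, 10)); (1, (2, 2))]); ((1, 5), [:: (1, (0, 11))])];
  cd_next := [::]
|}.

Definition words2 : seq (vertex Q * seq (arrow Q)) :=
  [:: (V1, [::]); (V2, [::]); (V2, [:: Alpha]); (V2, [:: Alpha; Alpha]);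
      (V2, [:: Alpha; Alpha; Alpha]); (V2, [:: Alpha; Alpha; Alpha; Alpha]);
      (V2, [:: Gamma]); (V2, [:: Alpha; Gamma]); (V1, [:: Beta]); (V1, [:: Beta; Alpha]);
      (V1, [:: Beta; Gamma])].

Definition rels2 : seq (seq (arrow Q) * option (seq (arrow Q))) :=
  [:: ([:: Alpha; Alpha; Gamma], None); ([:: Beta; Alpha; Alpha], None);
      ([:: Beta; Gamma], Some [:: Beta; Alpha; Gamma]);
      ([:: Alpha; Alpha; Alpha], Some [:: Gamma; Beta])].

Definition rules2 : seq (seq (arrow Q) * option (seq (arrow Q))) :=
  [:: ([:: Gamma; Beta], Some [:: Alpha; Alpha; Alpha]);
      ([:: Beta; Alpha; Gamma], Some [:: Beta; Gamma]); ([:: Alpha; Alpha; Gamma], None);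
      ([:: Beta; Alpha; Alpha], None); ([:: Alpha; Alpha; Alpha; Alpha; Alpha], None)].

Definition mul2 := Eval vm_compute in word_table words2 rules2.

Definition resolution2 : resolution_data := {|
  rd_dim := 11;
  rd_mul := mul2;
  rd_gens :=
    [:: [:: (0, 0); (1, 1)];
        [:: (0, 1); (1, 0); (1, 1)];
        [:: (0, 0); (0, 1); (1, 0); (1, 1)];
        [:: (0, 0); (0, 1); (1, 0); (1, 1)]];
  rd_diff :=
    [:: [:: [:: (1, (0, (0, 8))); (2, (1, (8, 1)))];
          [:: (1, (0, (6, 0))); (2, (1, (1, 6)))];
          [:: (1, (1, (1, 2))); (2, (1, (2, 1)))]];
      [:: [:: (1, (0, (0, 6))); (2, (0, (0, 7))); (2, (1, (8, 0))); (1, (1, (9, 0)));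
              (2, (2, (8, 6)))];
          [:: (1, (0, (0, 3))); (1, (2, (8, 2))); (1, (2, (9, 1)))];
          [:: (1, (1, (3, 0))); (2, (2, (1, 7))); (2, (2, (2, 6)))];
          [:: (1, (0, (6, 1))); (2, (1, (1, 8))); (2, (2, (1, 3))); (2, (2, (2, 2)));
              (2, (2, (3, 1)))]];
      [:: [:: (1, (1, (0, 6))); (1, (2, (8, 0)))];
          [:: (1, (0, (0, 8))); (2, (1, (0, 2))); (1, (1, (0, 3))); (2, (3, (8, 1)));
              (1, (3, (9, 1)))];
          [:: (1, (0, (6, 0))); (1, (2, (2, 0))); (2, (2, (3, 0))); (2, (3, (1, 6)));
              (1, (3, (1, 7)))];
          [:: (1, (1, (6, 1))); (1, (2, (1, 8))); (2, (3, (1, 3))); (1, (3, (3, 1)))]]];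
  rd_unit :=
    [:: (0, [:: (1, (0, (0, 0)))]); (1, [:: (1, (1, (1, 1)))]); (2, [:: (1, (1, (1, 2)))]);
        (3, [:: (1, (1, (1, 3)))]); (4, [:: (1, (1, (1, 4)))]); (5, [:: (1, (1, (1, 5)))]);
        (6, [:: (1, (1, (1, 6)))]); (7, [:: (1, (1, (1, 7)))]); (8, [:: (1, (0, (0, 8)))]);
        (9, [:: (1, (0, (0, 9)))]); (10, [:: (1, (0, (0, 10)))])];
  rd_htp :=
    [:: [:: ((0, 6), [:: (1, (1, (1, 0)))]);
          ((0, 7), [:: (1, (1, (2, 0))); (2, (2, (1, 6)))]);
          ((0, 10), [:: (2, (0, (0, 6))); (1, (1, (8, 0)))]);
          ((1, 2), [:: (2, (2, (1, 1)))]);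
          ((1, 3), [:: (2, (2, (1, 2))); (2, (2, (2, 1)))]);
          ((1, 4), [:: (2, (0, (6, 1))); (1, (1, (1, 8)))]);
          ((1, 5), [:: (2, (0, (7, 1))); (1, (1, (2, 8))); (2, (2, (1, 4)))]);
          ((1, 8), [:: (2, (0, (0, 1)))]);
          ((1, 9), [:: (2, (0, (0, 2))); (2, (2, (8, 1)))])];
      [:: ((0, 10), [:: (1, (1, (0, 2))); (1, (3, (8, 1)))]);
          ((1, 3), [:: (1, (2, (1, 0)))]);
          ((1, 4), [:: (1, (2, (2, 0))); (2, (3, (1, 6)))]);
          ((1, 5), [:: (1, (2, (3, 0))); (2, (3, (2, 6)))]);
          ((1, 9), [:: (1, (0, (0, 0)))]);
          ((2, 3), [:: (2, (3, (1, 1)))]);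
          ((2, 4), [:: (1, (3, (1, 2))); (2, (3, (2, 1)))]);
          ((2, 5), [:: (1, (1, (6, 1))); (2, (3, (1, 3))); (1, (3, (2, 2)))]);
          ((2, 9), [:: (1, (1, (0, 1)))])];
      [:: ((0, 6), [:: (1, (2, (1, 0)))]);
          ((0, 7), [:: (1, (0, (6, 0))); (1, (2, (2, 0)))]);
          ((0, 10), [:: (1, (1, (0, 6))); (2, (1, (0, 7))); (1, (2, (9, 0)))]);
          ((1, 7), [:: (2, (0, (6, 9))); (2, (0, (7, 8))); (1, (1, (6, 1)));
                      (1, (1, (6, 2))); (1, (1, (7, 1))); (1, (1, (7, 2)));
                      (2, (2, (1, 8))); (2, (2, (1, 9))); (2, (2, (2, 8)));
                      (2, (2, (2, 9))); (2, (2, (3, 8))); (2, (3, (1, 4)));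
                      (1, (3, (1, 5))); (1, (3, (2, 1))); (1, (3, (2, 2)))]);
          ((1, 10), [:: (2, (0, (0, 8))); (1, (3, (8, 1)))]);
          ((2, 4), [:: (1, (0, (6, 0)))]);
          ((2, 5), [:: (2, (1, (6, 6))); (1, (1, (6, 7))); (1, (2, (4, 0)));
                      (2, (2, (5, 0)))]);
          ((2, 8), [:: (1, (0, (0, 0)))]);
          ((2, 9), [:: (2, (1, (0, 6))); (1, (1, (0, 7))); (1, (2, (8, 0)));
                      (2, (2, (9, 0)))]);
          ((3, 3), [:: (1, (3, (1, 1)))]);
          ((3, 4), [:: (1, (0, (6, 9))); (1, (0, (7, 8))); (2, (1, (6, 1)));
                      (2, (1, (6, 2))); (2, (1, (7, 1))); (2, (1, (7, 2)));
                      (1, (2, (1, 8))); (1, (2, (1, 9))); (1, (2, (2, 8)));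
                      (1, (2, (2, 9))); (1, (2, (3, 8))); (1, (3, (1, 4)));
                      (2, (3, (1, 5))); (2, (3, (2, 2)))]);
          ((3, 5), [:: (1, (0, (6, 9))); (1, (0, (7, 8))); (2, (1, (6, 2)));
                      (2, (1, (7, 1))); (2, (1, (7, 2))); (1, (2, (1, 9)));
                      (1, (2, (2, 8))); (1, (2, (2, 9))); (1, (2, (3, 8)));
                      (1, (3, (1, 4))); (2, (3, (1, 5))); (2, (3, (2, 2)))]);
          ((3, 9), [:: (1, (1, (0, 1)))])]]
|}.

(** The centre: beta gamma, alpha^2, alpha^3, alpha^4, 1. *)
Definition cohomology2_0 : cohomology_data := {|
  cd_cls := [:: [:: (1, (0, 10))]; [:: (1, (1, 3))]; [:: (1, (1, 4))]; [:: (1, (1, 5))];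
                [:: (1, (0, 0)); (1, (1, 1))]];
  cd_coord :=
    [:: ((0, 10), [:: (1, 0)]); ((1, 1), [:: (1, 4)]); ((1, 3), [:: (1, 1)]);
        ((1, 4), [:: (1, 2)]); ((1, 5), [:: (1, 3)])];
  cd_prev := [::];
  cd_next :=
    [:: ((0, 8), [:: (1, (0, 0))]); ((0, 9), [:: (2, (1, 2))])]
|}.

(** The derivations that send alpha to alpha^2, alpha^3 or alpha^4 and kill beta and gamma; the
    first respects alpha^3 = gamma beta because 3 alpha^4 = 0. *)
Definition cohomology2_1 : cohomology_data := {|
  cd_cls := [:: [:: (1, (2, 3))]; [:: (1, (2, 4))]; [:: (1, (2, 5))]];
  cd_coord :=
    [:: ((2, 3), [:: (1, 0)]); ((2, 4), [:: (1, 1)]); ((2, 5), [:: (1, 2)])];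
  cd_prev :=
    [:: ((1, 6), [:: (1, (0, 0))]); ((1, 7), [:: (2, (1, 2))])];
  cd_next :=
    [:: ((0, 10), [:: (2, (2, 2))]); ((1, 9), [:: (2, (2, 1)); (1, (2, 2))]);
        ((3, 4), [:: (1, (0, 8))]); ((3, 5), [:: (1, (0, 9)); (1, (2, 2))])]
|}.

Definition cohomology2_2 : cohomology_data := {|
  cd_cls := [:: [:: (1, (3, 3))]; [:: (1, (0, 0)); (1, (3, 1)); (1, (3, 2))];
                [:: (1, (1, 8)); (2, (2, 6)); (2, (3, 2))]];
  cd_coord :=
    [:: ((3, 1), [:: (1, 1); (1, 2)]); ((3, 2), [:: (2, 2)]); ((3, 3), [:: (1, 0)])];
  cd_prev :=
    [:: ((0, 10), [:: (2, (2, 2))]); ((2, 7), [:: (1, (2, 1)); (2, (2, 2))]);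
        ((3, 4), [:: (1, (0, 8))]); ((3, 5), [:: (1, (0, 9)); (1, (2, 2))])];
  cd_next :=
    [:: ((0, 10), [:: (1, (1, 9))]); ((1, 8), [:: (1, (0, 0))]);
        ((1, 9), [:: (2, (1, 8)); (1, (1, 9))]); ((2, 7), [:: (2, (1, 9)); (1, (2, 6))])]
|}.
Definition vertices : seq (vertex Q) := [:: V1; V2].
Definition arrows : seq (arrow Q) := [:: Alpha; Beta; Gamma].

Lemma mem_vertices v : v \in vertices. Proof. by case: v. Qed.
Lemma mem_arrows a : a \in arrows. Proof. by case: a. Qed.

Local Open Scope ring_scope.

(** * Derivation of the rewriting rules from the relations *)

Section Rules.
Variables (R : pzRingType) (f : Qarrow -> R).
Local Notation a := (f Alpha).
Local Notation b := (f Beta).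
Local Notation c := (f Gamma).

Lemma word_rels1 :
  [:: a ^+ 2 - c * b; b * a * c - b * a ^+ 2 * c; a ^+ 5] =
  [seq word_val f r.1 - oword_val f r.2 | r <- rels1].
Proof. by rewrite /= !word_val_cons !word_val_nil !mulr1 subr0 !exprS !expr0 !mulr1 !mulrA. Qed.

Lemma word_rels2 :
  [:: a ^+ 2 * c; b * a ^+ 2; b * c - b * a * c; a ^+ 3 - c * b] =
  [seq word_val f r.1 - oword_val f r.2 | r <- rels2].
Proof. by rewrite /= !word_val_cons !word_val_nil !mulr1 !subr0 !exprS !expr0 !mulr1 !mulrA. Qed.

Lemma rules1P :
  (forall r, r \in rels1 -> word_val f r.1 = oword_val f r.2) ->
  forall r, r \in rules1 -> word_val f r.1 = oword_val f r.2.
Proof.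
move=> H.
have r1 : a * a = c * b.
  by have := H _ (mem_nth ([::], None) (isT : 0 < size rels1)%N);
    rewrite /= !word_val_cons !word_val_nil !mulr1.
have r2 : b * a * c = b * a * a * c.
  by have := H _ (mem_nth ([::], None) (isT : 1 < size rels1)%N);
    rewrite /= !word_val_cons !word_val_nil !mulr1 !mulrA.
have r3 : a * a * a * a * a = 0.
  by have := H _ (mem_nth ([::], None) (isT : 2 < size rels1)%N);
    rewrite /= !word_val_cons !word_val_nil !mulr1 !mulrA.
(* alpha^3 gamma = gamma beta alpha gamma = gamma beta alpha^2 gamma = alpha^4 gamma; applied twice,
   this gives alpha^5 gamma = 0. The case of beta alpha^3 is symmetric. *)
have aac : a * a * a * c = a * a * a * a * c.
  by rewrite r1 -!mulrA ![b * _]mulrA r2 !mulrA.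
have baa : b * a * a * a = b * a * a * a * a.
  by rewrite -!mulrA r1 ![b * _]mulrA !mulrA r2 -!mulrA.
have aac0 : a * a * a * c = 0.
  have e : a * a * a * a * c = a * (a * a * a * c) by rewrite !mulrA.
  by rewrite aac e aac !mulrA r3 mul0r.
have baa0 : b * a * a * a = 0.
  have e : b * a * a * a * a = b * a * a * a * a * a by rewrite {1}baa.
  by rewrite baa e -!mulrA [a * (a * (a * (a * a)))](_ : _ = 0) ?mulr0 // !mulrA.
move=> r; rewrite !inE => /or4P[/eqP->|/eqP->|/eqP->|/orP[]/eqP->];
  by rewrite /= !word_val_cons !word_val_nil !mulr1 ?mulrA.
Qed.

Lemma rules2P :
  (forall r, r \in rels2 -> word_val f r.1 = oword_val f r.2) ->
  forall r, r \in rules2 -> word_val f r.1 = oword_val f r.2.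
Proof.
move=> H.
have r1 : a * a * c = 0.
  by have := H _ (mem_nth ([::], None) (isT : 0 < size rels2)%N);
    rewrite /= !word_val_cons !word_val_nil !mulr1 !mulrA.
have r2 : b * a * a = 0.
  by have := H _ (mem_nth ([::], None) (isT : 1 < size rels2)%N);
    rewrite /= !word_val_cons !word_val_nil !mulr1 !mulrA.
have r3 : b * c = b * a * c.
  by have := H _ (mem_nth ([::], None) (isT : 2 < size rels2)%N);
    rewrite /= !word_val_cons !word_val_nil !mulr1 !mulrA.
have r4 : a * a * a = c * b.
  by have := H _ (mem_nth ([::], None) (isT : 3 < size rels2)%N);
    rewrite /= !word_val_cons !word_val_nil !mulr1 !mulrA.
have aaaaa : a * a * a * a * a = 0.
  by rewrite -!mulrA [a * (a * a)]mulrA r4 !mulrA r1 mul0r.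
move=> r; rewrite !inE => /or4P[/eqP->|/eqP->|/eqP->|/orP[]/eqP->];
  by rewrite /= !word_val_cons !word_val_nil !mulr1 ?mulrA.
Qed.

End Rules.

Lemma Lambda1_relsE (K : fieldType) : Lambda1_rels K = [seq relation K r | r <- rels1].
Proof. exact: (word_rels1 (@arrow_elt K Q)). Qed.

Lemma Lambda2_relsE (K : fieldType) : Lambda2_rels K = [seq relation K r | r <- rels2].
Proof. exact: (word_rels2 (@arrow_elt K Q)). Qed.

Local Close Scope ring_scope.
Unset Implicit Arguments.

Theorem proposition6p2 (K : closedFieldType) (A : falgType K)
    (charK : 3 \in [pchar K]%R) (hA : is_Lambda1 A \/ is_Lambda2 A) :
  HH_dim A 0 5 /\ HH_dim A 1 3 /\ HH_dim A 2 3.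
Proof.
case: hA => [hA|hA].
  rewrite /is_Lambda1 Lambda1_relsE in hA.
  (* Exactness is needed up to degree 2, the last degree of cohomology considered, and this involves
     the terms up to degree 3. *)
  have HH := @HH_dim_bound_quiver K 3 Q A rels1 words1 rules1 _ _ resolution1 2
    charK hA mem_vertices mem_arrows (@rules1P A) _ _ _.
  split; [|split].
  - by apply: (HH _ _ _ 0 cohomology1_0); vm_compute.
  - by apply: (HH _ _ _ 1 cohomology1_1); vm_compute.
  - by apply: (HH _ _ _ 2 cohomology1_2); vm_compute.
rewrite /is_Lambda2 Lambda2_relsE in hA.
have HH := @HH_dim_bound_quiver K 3 Q A rels2 words2 rules2 _ _ resolution2 2
  charK hA mem_vertices mem_arrows (@rules2P A) _ _ _.
split; [|split].
- by apply: (HH _ _ _ 0 cohomology2_0); vm_compute.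
- by apply: (HH _ _ _ 1 cohomology2_1); vm_compute.
- by apply: (HH _ _ _ 2 cohomology2_2); vm_compute.
Qed.
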